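(* Let $\pi, \tau \in \mathfrak{S}_m$ be standard permutations. If $\pi \overset{s}{\sim} \tau$ (that is, $\pi$ and $\tau$ are strongly c-Wilf equivalent), then $(\pi_1, \pi_m) = (\tau_1, \tau_m)$.
   Context: $\mathfrak{S}_m$ is the set of permutations of $\{1,\dots,m\}$, written in one-line notation $\pi = \pi_1 \pi_2 \cdots \pi_m$. The standardization of a sequence of $k$ distinct positive integers is the sequence obtained by replacing its $i$th smallest entry by $i$, for $1 \le i \le k$. Given $\pi \in \mathfrak{S}_m$ and $\sigma \in \mathfrak{S}_n$, an occurrence of $\pi$ in $\sigma$ as a consecutive pattern is a subsequence of consecutive entries $\sigma_i \sigma_{i+1} \cdots \sigma_{i+m-1}$ of $\sigma$ whose standardization is $\pi$. Permutations $\pi, \tau \in \mathfrak{S}_m$ are strongly c-Wilf equivalent, written $\pi \overset{s}{\sim} \tau$, if for all $n$ and $k$ the number of permutations in $\mathfrak{S}_n$ with exactly $k$ occurrences of $\pi$ as a consecutive pattern equals the number with exactly $k$ occurrences of $\tau$ as a consecutive pattern. A permutation $\pi \in \mathfrak{S}_m$ is standard if $\pi_1 < \pi_m$ and $\pi_1 + \pi_m \le m+1$. *)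

(* Defs.v *)
From mathcomp Require Import all_boot all_fingroup.

Set Implicit Arguments.
Unset Strict Implicit.
Unset Printing Implicit Defensive.

(* The elements of 'S_m permute 'I_m = {0, ..., m-1}; positions and values are
   shifted by one in [one_line] and [entry] to act on {1, ..., m}. *)
Definition one_line (m : nat) (p : 'S_m) : seq nat :=
  [seq (p i).+1 | i : 'I_m].

(* [entry p i] is p_i for 1 <= i <= m; elsewhere its value is irrelevant. *)
Definition entry (m : nat) (p : 'S_m) (i : nat) : nat :=
  nth 0 (one_line p) i.-1.

Definition standardization (s : seq nat) : seq nat :=
  [seq (index x (sort leq s)).+1 | x <- s].

(* The occurrence starts at the 0-based position i, so its entries are
   s_(i+1), ..., s_(i+m) in 1-based notation. *)
Definition occurs_at (m n : nat) (p : 'S_m) (s : 'S_n) (i : nat) : bool :=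
  (i + m <= n) &&
  (standardization (take m (drop i (one_line s))) == one_line p).

Definition occurrences (m n : nat) (p : 'S_m) (s : 'S_n) : nat :=
  #|[set i : 'I_n | occurs_at p s i]|.

Definition strongly_c_wilf_equivalent (m : nat) (p t : 'S_m) : Prop :=
  forall n k : nat,
    #|[set s : 'S_n | occurrences p s == k]| =
    #|[set s : 'S_n | occurrences t s == k]|.

(* For m = 0 there is no first entry; the strict inequality then reads 0 < 0,
   so the empty permutation is not standard. *)
Definition standard (m : nat) (p : 'S_m) : bool :=
  (entry p 1 < entry p m) && (entry p 1 + entry p m <= m + 1).

(* Main.v *)
Require Import Defs.
From mathcomp Require Import all_boot all_order all_algebra all_fingroup.
From mathcomp Require Import zify ring lra.

Set Implicit Arguments.
Unset Strict Implicit.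
Unset Printing Implicit Defensive.

(** Why the theorem is true.  Let m = N + 1 and let x be the number of values
    below the first entry of a standard pattern, d the difference between its
    last and first entries and y the number of values above its last entry, so
    that x + d + y = N, d >= 1 and x <= y.  The pair of end values is the same
    datum as (x, d), given N.

    Goulden and Jackson's cluster method turns the equidistribution of the
    number of occurrences into the equality of all cluster counts: the counts of
    words with marked, overlapping occurrences that leave no gap.  The clusters
    with k marks and the largest possible length k N + 1 are those in which
    consecutive windows share a single letter, and their number depends on
    (x, d, y) only.  It is convenient to count words over [0, M) rather than
    permutations, and to keep only the leading term as M grows: then the counts
    of independent blocks multiply, and repeated letters are negligible.  In this
    form the outcome is that, for each k, the two patterns give chain sums
    (lemma chain_sum_close) with equal leading terms.  The chain sum is

      sum over u_0 < u_1 < ... < u_(kd) in [0, M) of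
        the product over j < k of binom(u_(jd), x)
        times the product over 0 < j <= k of binom(M - 1 - u_(jd), y):

    the u_i form a spine through all the windows, and at the shared letters
    x letters hang below and y letters hang above.

    Three comparisons of growth in k recover (x, d).

    - The leading coefficient is 1 / (k d + 1)! up to factors exponential in k,
      hence d is determined (close_same_gap).

    - If d = 1, then k = 2 suffices: the leading coefficient is proportional to
      h(x) h(y) with h(x) = binom(2x + 1, x), and h is strictly log-convex, so
      that x + y being given, x is determined (close_unit_gap).

    - If d >= 2, the exponential rate decides (close_wide_gap).  Scale the
      letters to [0, 1] and replace the weight u^x carried by one spine letter
      out of d by u^(x/d) on every spine letter, and likewise for (1 - u)^y.
      Since these functions are monotone the replacement is an inequality in both
      directions, up to a factor that does not depend on k, and for the new
      weights the integral over the spine is T^(kd+1) / (kd+1)! with T a Beta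
      integral.  Apart from the factorial, the rate is therefore that of
      (T^d / (x! y!))^k.  With f(x) = d log Gamma(1 + x/d) -
      log Gamma(1 + x) its logarithm is f(x) + f(y) plus a function of x + y and
      d; as f is strictly concave, a more balanced pair (x, y) has
      exponentially more chains (spread_dominates).

    The last comparison is carried out with rational numbers only.  The power
    u^(x/d) becomes the product of the 1 + (x/d)/s for 1 <= s <= u, whose
    convolutions are explicit by the Chu-Vandermonde identity (rising_conv);
    the values of Gamma become the products root_defect, in which each factor
    separately favours the balanced pair (defect_factor_spread). *)

(** * Words *)

Fixpoint words (T : Type) (A : seq T) (n : nat) : seq (seq T) :=
  if n is n'.+1 then [seq a :: w | a <- A, w <- words A n'] else [:: [::]].

Lemma sum_words0 (T : Type) (A : seq T) (F : seq T -> nat) :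
  \sum_(w <- words A 0) F w = F [::].
Proof. by rewrite big_seq1. Qed.

Lemma sum_wordsS (T : Type) (A : seq T) n (F : seq T -> nat) :
  \sum_(w <- words A n.+1) F w =
  \sum_(a <- A) \sum_(w <- words A n) F (a :: w).
Proof. by rewrite /= big_allpairs_dep. Qed.

Lemma sum_words_cat (T : Type) (A : seq T) n1 n2 (F : seq T -> nat) :
  \sum_(w <- words A (n1 + n2)) F w =
  \sum_(w1 <- words A n1) \sum_(w2 <- words A n2) F (w1 ++ w2).
Proof.
elim: n1 F => [|n1 IHn] F; first by rewrite sum_words0.
rewrite addSn !sum_wordsS; apply: eq_bigr => a _.
by rewrite IHn.
Qed.

Lemma sum_words1 (T : Type) (A : seq T) (F : seq T -> nat) :
  \sum_(w <- words A 1) F w = \sum_(a <- A) F [:: a].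
Proof. by rewrite sum_wordsS; apply: eq_bigr => a _; rewrite sum_words0. Qed.

Lemma sum_words_rcons (T : Type) (A : seq T) n (F : seq T -> nat) :
  \sum_(w <- words A n.+1) F w =
  \sum_(w <- words A n) \sum_(a <- A) F (rcons w a).
Proof.
rewrite -addn1 sum_words_cat; apply: eq_bigr => w _.
by rewrite sum_words1; apply: eq_bigr => a _; rewrite cats1.
Qed.

Lemma mem_words (T : eqType) (A : seq T) n w :
  (w \in words A n) = (size w == n) && all (mem A) w.
Proof.
elim: n w => [|n IHn] [|a w] //=.
  by apply/negbTE/negP => /allpairsP[[? ?] []].
apply/allpairsP/idP => [[[b v] /= [bA]]|].
  by rewrite IHn => /andP[/eqP <- vA] [-> ->]; rewrite eqxx bA.
by case/and3P => sw aA wA; exists (a, w); split; rewrite //= IHn -eqSS sw.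
Qed.

Lemma words_uniq (T : eqType) (A : seq T) n : uniq A -> uniq (words A n).
Proof.
move=> uA; elim: n => //= n IHn.
by apply: allpairs_uniq => // -[a w] [b v] _ _ [-> ->].
Qed.

Lemma size_words (T : Type) (A : seq T) n : size (words A n) = size A ^ n.
Proof. by elim: n => //= n IHn; rewrite size_allpairs IHn expnS. Qed.

(** * Marked occurrences and clusters *)

Section Clusters.

Variables (m : nat) (p : 'S_m).

(** The order form of an occurrence.  It reads only the letters of the window,
    which makes occurrences in disjoint windows independent, and it is meaningful
    for words with repeated letters. *)
Definition occ (w : seq nat) (i : nat) : bool :=
  (i + m <= size w) &&
  [forall a : 'I_m, forall b : 'I_m,
     (nth 0 w (i + a) < nth 0 w (i + b)) == (p a < p b)].

Lemma occ_catl w1 w2 i : i + m <= size w1 -> occ (w1 ++ w2) i = occ w1 i.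
Proof.
move=> im; rewrite /occ size_cat im (leq_trans im) ?leq_addr //=.
apply: eq_forallb => a; apply: eq_forallb => b.
have ha := ltn_ord a; have hb := ltn_ord b.
by rewrite !nth_cat !ifT //; lia.
Qed.

Lemma occ_catr w1 w2 i : occ (w1 ++ w2) (size w1 + i) = occ w2 i.
Proof.
rewrite /occ size_cat -addnA leq_add2l; congr (_ && _).
apply: eq_forallb => a; apply: eq_forallb => b.
by rewrite !nth_cat !ifF; [congr ((nth _ _ _ < nth _ _ _) == _); lia | lia | lia].
Qed.

Definition occ_count (w : seq nat) : nat := count (occ w) (iota 0 (size w)).

Definition marked (b : bitseq) (w : seq nat) : bool :=
  all (fun i => nth false b i ==> occ w i) (iota 0 (size b)).

Lemma markedP b w :
  reflect (forall i, nth false b i -> occ w i) (marked b w).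
Proof.
apply: (iffP allP) => [H i bi|H i _]; last by apply/implyP/H.
have : i \in iota 0 (size b).
  by rewrite mem_iota; case: ltnP => // le_b_i; rewrite nth_default in bi.
by move/H/implyP; apply.
Qed.

Definition fits (b : bitseq) : bool :=
  all (fun i => nth false b i ==> (i + m <= size b)) (iota 0 (size b)).

Lemma nth_true_lt (b : bitseq) i : nth false b i -> i < size b.
Proof. by case: ltnP => // h; rewrite nth_default. Qed.

Lemma fitsP b :
  reflect (forall i, nth false b i -> i + m <= size b) (fits b).
Proof.
apply: (iffP allP) => [H i bi|H i _]; last by apply/implyP/H.
have : i \in iota 0 (size b) by rewrite mem_iota nth_true_lt.
by move/H/implyP; apply.
Qed.

Definition cut (b : bitseq) (c : nat) : bool :=
  all (fun i => nth false b i ==> (i + m <= c) || (c <= i)) (iota 0 (size b)).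

Lemma cutP b c :
  reflect (forall i, nth false b i -> (i + m <= c) || (c <= i)) (cut b c).
Proof.
apply: (iffP allP) => [H i bi|H i _]; last by apply/implyP/H.
have : i \in iota 0 (size b) by rewrite mem_iota nth_true_lt.
by move/H/implyP; apply.
Qed.

(** The blocks of the cluster method: the marked windows overlap so much that
    every interior position lies strictly inside one of them.  A single uncovered
    letter is a cluster as well. *)
Definition cluster (b : bitseq) : bool :=
  [&& 0 < size b, fits b & ~~ has (cut b) (iota 1 (size b).-1)].

Lemma clusterP b :
  reflect [/\ 0 < size b, fits b & forall c, 0 < c < size b -> ~~ cut b c]
          (cluster b).
Proof.
apply: (iffP and3P) => -[sb fb H]; split => //.
  move=> c hc; apply: contra H => cc; apply/hasP; exists c => //.
  by rewrite mem_iota; lia.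
by apply/hasPn => c; rewrite mem_iota => hc; apply: H; lia.
Qed.

Lemma fits_cut b : fits b -> cut b (size b).
Proof. by move=> /fitsP H; apply/cutP => i /H ->. Qed.

Lemma cluster_take b c : 0 < c <= size b ->
  cluster (take c b) <-> cut b c /\ forall c', 0 < c' < c -> ~~ cut b c'.
Proof.
move=> /andP[c0 cb].
have sc : size (take c b) = c by rewrite size_take; case: ltnP => //; lia.
have fc : fits (take c b) = cut b c.
  apply/fitsP/cutP; rewrite sc => H i.
    by move=> bi; case: (leqP c i) => ci; rewrite ?orbT // H ?nth_take.
  case: (ltnP i c) => ic; last by rewrite nth_default ?sc.
  by rewrite nth_take // => /H; lia.
have cc c' : 0 < c' < c -> cut (take c b) c' = cut b c'.
  move=> /andP[_ c'c]; apply/cutP/cutP => H i bi.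
    case: (ltnP i c) => ic; last by rewrite (_ : c' <= i) ?orbT //; lia.
    by apply: H; rewrite nth_take.
  apply: H; move: bi; case: (ltnP i c) => ic; last by rewrite nth_default ?sc.
  by rewrite nth_take.
split.
  move/clusterP; rewrite sc fc => -[_ cutc H]; split => // c' hc'.
  by rewrite -cc // H.
case=> cutc H; apply/clusterP; rewrite sc fc; split => // c' hc'.
by rewrite cc // H.
Qed.

Lemma fits_drop b c : fits b -> fits (drop c b).
Proof.
move=> /fitsP H; apply/fitsP => i; rewrite nth_drop size_drop => /H; lia.
Qed.

(** The only prefix that can be split off as a cluster ends at the smallest cut,
    and there is one because the end of the word is a cut.  Writing uniqueness as
    a sum equal to 1 lets the decomposition at the first cluster be inserted into
    any sum over marks. *)
Lemma first_cluster b : fits b -> 0 < size b ->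
  \sum_(1 <= c < (size b).+1) (cluster (take c b) && fits (drop c b)) = 1.
Proof.
move=> fb sb.
have ex : exists c, (0 < c) && cut b c.
  by exists (size b); rewrite sb fits_cut.
case: (ex_minnP ex) => c0 /andP[c00 cc0] minc.
have c0b : c0 <= size b by apply: minc; rewrite sb fits_cut.
rewrite (big_cat_nat _ (n := c0)) //=; last by lia.
rewrite (@big_nat_recl _ _ _ (size b) c0) //.
rewrite (_ : cluster (take c0 b) && fits (drop c0 b)); last first.
  rewrite fits_drop // andbT; apply/cluster_take; first by rewrite c00.
  split=> // c' hc'; apply/negP => cc'.
  by have := minc c'; rewrite cc'; lia.
rewrite big_nat_cond big1 ?add0n; last first.
  move=> c /andP[hc _]; apply/eqP; rewrite eqb0; apply/negP => /andP[hcl _].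
  case: ((cluster_take (_ : 0 < c <= size b)).1 hcl) => [|cc _]; first by lia.
  by have := minc c; rewrite cc; lia.
rewrite big_nat_cond big1 ?addn0 // => c /andP[hc _].
apply/eqP; rewrite eqb0; apply/negP => /andP[hcl _].
case: ((cluster_take (_ : 0 < c.+1 <= size b)).1 hcl) => [|_ H]; first by lia.
by have := H c0; rewrite cc0; lia.
Qed.

(** When no marked window straddles the junction, the conditions on the two
    parts involve disjoint sets of letters. *)
Lemma marked_cat b1 b2 w1 w2 : fits b1 -> size w1 = size b1 ->
  marked (b1 ++ b2) (w1 ++ w2) = marked b1 w1 && marked b2 w2.
Proof.
move=> /fitsP fb sw; apply/markedP/andP => [H|[/markedP H1 /markedP H2] i].
  split; apply/markedP => i bi.
    have ib := nth_true_lt bi.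
    rewrite -(@occ_catl w1 w2) ?sw; last exact: fb.
    by apply: H; rewrite nth_cat ib.
  rewrite -(@occ_catr w1 w2); apply: H.
  by rewrite nth_cat sw ltnNge leq_addr /= addKn.
rewrite nth_cat; case: ltnP => ib bi.
  by rewrite occ_catl ?H1 // sw; apply: fb.
by have := H2 _ bi; rewrite -(@occ_catr w1 w2) sw subnKC.
Qed.

Lemma marked_fits b w : size w = size b -> marked b w -> fits b.
Proof.
by move=> sw /markedP H; apply/fitsP => i /H /andP[]; rewrite sw.
Qed.

End Clusters.

(** * Counting marked words *)

Definition bits := [:: true; false].

(** Marking k of the occurrences of a word amounts to choosing a k-subset of
    them; this is what makes the sums over marks below functions of the
    distribution of the number of occurrences. *)
Lemma sum_submasks (o : bitseq) k :
  \sum_(b <- words bits (size o)) ((count id b == k) && all2 implb b o : nat) =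
  'C(count id o, k).
Proof.
elim: o k => [|x o IHo] k /=; first by rewrite big_seq1; case: k.
have E := sum_wordsS bits (size o)
  (fun b => ((count id b == k) && all2 implb b (x :: o) : nat)).
rewrite [LHS]E !big_cons big_nil addn0 /=; case: x {E} => /=.
  rewrite [X in _ + X](_ : _ = 'C(count id o, k)); last by rewrite -IHo.
  case: k => [|k].
    by rewrite !bin0 big1 // => b _.
  by rewrite add1n binS addnC -[X in _ + X = _]/(\sum_(b <- words bits (size o))
    ((count id b == k) && all2 implb b o : nat)) IHo.
rewrite add0n -IHo big1 ?add0n // => b _.
by rewrite andbF.
Qed.

Section Totals.

Variables (m : nat) (p : 'S_m) (M : nat).

Definition marked_count (b : bitseq) : nat :=
  \sum_(w <- words (iota 0 M) (size b)) marked p b w.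

Definition marking_count n k : nat :=
  \sum_(w <- words (iota 0 M) n) 'C(occ_count p w, k).

Definition cluster_count n k : nat :=
  \sum_(b <- words bits n) (cluster m b && (count id b == k)) * marked_count b.

Lemma all2_nth (b o : bitseq) : size b = size o ->
  all2 implb b o =
  all (fun i => nth false b i ==> nth false o i) (iota 0 (size b)).
Proof.
elim: b o => [|x b IHb] [|z o] //= [sb]; rewrite IHb //; congr (_ && _).
by rewrite (iotaDl 1 0) all_map; apply: eq_all.
Qed.

Lemma markedE b w : marked p b w = all2 implb b (mkseq (occ p w) (size b)).
Proof.
rewrite all2_nth ?size_mkseq //; apply: eq_in_all => i.
by rewrite mem_iota => /andP[_ ib]; rewrite nth_mkseq.
Qed.

Lemma size_in_words (T : eqType) (A : seq T) n w : w \in words A n -> size w = n.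
Proof. by rewrite mem_words => /andP[/eqP]. Qed.

Lemma marking_countE n k :
  marking_count n k = \sum_(b <- words bits n) (count id b == k) * marked_count b.
Proof.
transitivity (\sum_(b <- words bits n) \sum_(w <- words (iota 0 M) n)
                ((count id b == k) && marked p b w : nat)).
  rewrite exchange_big /=; apply: eq_big_seq => w /size_in_words sw.
  have E : occ_count p w = count id (mkseq (occ p w) (size w)).
    by rewrite /mkseq count_map; apply: eq_count.
  rewrite E -sum_submasks size_mkseq sw; apply: eq_big_seq => b /size_in_words sb.
  by rewrite markedE sb.
apply: eq_big_seq => b /size_in_words sb; rewrite /marked_count sb big_distrr /=.
by apply: eq_bigr => w _; rewrite mulnb.
Qed.

Lemma marked_count_not_fits b : ~~ fits m b -> marked_count b = 0.
Proof.
move=> nf; rewrite /marked_count big_seq big1 // => w /size_in_words sw.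
apply/eqP; rewrite eqb0; apply: contra nf; exact: marked_fits.
Qed.

Lemma marked_count_cat b1 b2 : fits m b1 ->
  marked_count (b1 ++ b2) = marked_count b1 * marked_count b2.
Proof.
move=> fb; rewrite /marked_count size_cat sum_words_cat big_distrl /=.
apply: eq_big_seq => w1 /size_in_words sw1; rewrite big_distrr /=.
by apply: eq_bigr => w2 _; rewrite marked_cat // mulnb.
Qed.

Lemma convol_eq a b k :
  (a + b == k : nat) = \sum_(j < k.+1) (a == j) * (b == k - j).
Proof.
case: (leqP a k) => ak.
  rewrite (bigD1 (inord a)) //= inordK // eqxx mul1n big1 ?addn0 => [|j].
    by congr nat_of_bool; lia.
  by rewrite -val_eqE /= inordK // eq_sym => /negbTE ->.
rewrite big1 => [|j _]; first by apply/eqP; rewrite eqb0; lia.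
by rewrite (_ : a == j = false) //; have := ltn_ord j; lia.
Qed.

(** Goulden and Jackson's recursion: a marked word is a cluster followed by a
    marked word, and the two are independent. *)
Lemma marking_count_rec n k : 0 < n ->
  marking_count n k =
  \sum_(1 <= c < n.+1) \sum_(j < k.+1)
     cluster_count c j * marking_count (n - c) (k - j).
Proof.
move=> n0; rewrite marking_countE.
transitivity (\sum_(b <- words bits n) \sum_(1 <= c < n.+1)
  (count id b == k) * marked_count b * (cluster m (take c b) && fits m (drop c b))).
  apply: eq_big_seq => b /size_in_words sb; rewrite -big_distrr /= -sb.
  case fb: (fits m b); first by rewrite first_cluster ?sb // muln1.
  by rewrite marked_count_not_fits ?fb // muln0.
rewrite exchange_big /=; rewrite [LHS]big_nat_cond [RHS]big_nat_cond.
apply: eq_bigr => c /andP[hc _].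
transitivity (\sum_(b1 <- words bits c) \sum_(b2 <- words bits (n - c))
   \sum_(j < k.+1) (cluster m b1 && (count id b1 == j)) * marked_count b1 *
      ((count id b2 == k - j) * marked_count b2)).
  rewrite -{1}(subnKC (_ : c <= n)); last by lia.
  rewrite sum_words_cat; apply: eq_big_seq => b1 /size_in_words sb1.
  apply: eq_bigr => b2 _; rewrite -sb1 take_size_cat // drop_size_cat //.
  rewrite count_cat convol_eq !big_distrl /=; apply: eq_bigr => j _.
  case cb: (cluster m b1); last by rewrite !muln0 !mul0n.
  have fb : fits m b1 by case/clusterP: cb.
  rewrite marked_count_cat //=; case fb2: (fits m b2); first by rewrite muln1; ring.
  by rewrite (marked_count_not_fits (b := b2)) ?fb2 // !muln0.
rewrite [RHS](eq_bigr (fun j : 'I_k.+1 => \sum_(b1 <- words bits c)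
   \sum_(b2 <- words bits (n - c))
   (cluster m b1 && (count id b1 == j)) * marked_count b1 *
      ((count id b2 == k - j) * marked_count b2))); last first.
  move=> j _; rewrite marking_countE /cluster_count big_distrl /=.
  by apply: eq_bigr => b1 _; rewrite big_distrr.
rewrite [RHS]exchange_big /=; apply: eq_bigr => b1 _.
by rewrite exchange_big.
Qed.

Lemma marking_count0 k : marking_count 0 k = (k == 0).
Proof. by rewrite /marking_count big_seq1 /occ_count /=; case: k. Qed.

Lemma marked_count_le b : marked_count b <= M ^ size b.
Proof.
rewrite /marked_count -[X in _ <= X ^ _](size_iota 0) -size_words.
rewrite -[size (words _ _)]sum1_size; apply: leq_sum => w _; exact: leq_b1.
Qed.

Lemma marking_count_le n k : marking_count n k <= 2 ^ n * M ^ n.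
Proof.
rewrite marking_countE -[in 2 ^ n](_ : size bits = 2) // -size_words.
rewrite -[size (words _ _)]sum1_size.
rewrite big_distrl /= big_seq [X in _ <= X]big_seq.
apply: leq_sum => b /size_in_words sb.
by rewrite leq_mul ?leq_b1 // -sb marked_count_le.
Qed.

Lemma cluster_count_le n k : cluster_count n k <= 2 ^ n * M ^ n.
Proof.
rewrite /cluster_count -[in 2 ^ n](_ : size bits = 2) // -size_words.
rewrite -[size (words _ _)]sum1_size.
rewrite big_distrl /= big_seq [X in _ <= X]big_seq.
apply: leq_sum => b /size_in_words sb.
by rewrite leq_mul ?leq_b1 // -sb marked_count_le.
Qed.

End Totals.

(** * From permutations to words *)

Section Standardization.

Variables (m : nat) (p : 'S_m).

Lemma size_one_line : size (one_line p) = m.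
Proof. by rewrite /one_line size_image card_ord. Qed.

Lemma nth_one_line (i : 'I_m) : nth 0 (one_line p) i = (p i).+1.
Proof.
rewrite /one_line /image_mem (nth_map i) ?size_enum_ord //.
by rewrite nth_ord_enum.
Qed.

(** Standardizing keeps the relative order of the entries, including ties. *)
Lemma ltn_index_sort (s : seq nat) x y : x \in s -> y \in s ->
  (index x (sort leq s) < index y (sort leq s)) = (x < y).
Proof.
move=> xs ys; set s' := sort leq s.
have xs' : x \in s' by rewrite mem_sort.
have ys' : y \in s' by rewrite mem_sort.
have ss : sorted leq s' by apply: sort_sorted; exact: leq_total.
have H u v : u \in s' -> v \in s' -> index u s' < index v s' -> u <= v.
  by move=> us vs; apply: (sorted_ltn_index leq_trans ss).
have I u v : u \in s' -> v \in s' -> index u s' = index v s' -> u = v.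
  by move=> us vs E; rewrite -(nth_index 0 us) E nth_index.
apply/idP/idP => h.
  rewrite ltn_neqAle (H x y) // andbT.
  by apply: contraL h => /eqP ->; rewrite ltnn.
rewrite ltnNge leq_eqVlt negb_or; apply/andP; split.
  by apply: contraL h => /eqP/(I _ _ ys' xs') ->; rewrite ltnn.
by apply: contraL h => /(H _ _ ys' xs'); rewrite -leqNgt.
Qed.

(** Recovers a permutation from its relative order. *)
Lemma card_below_perm n (q : 'S_n) a : #|[set b | q b < q a]| = q a.
Proof.
rewrite (_ : [set b | q b < q a] = q @^-1: [set c : 'I_n | c < q a]); last first.
  by apply/setP => b; rewrite !inE.
rewrite card_preimset; last exact: perm_inj.
rewrite -sum1dep_card -(big_ord_widen n (fun=> 1) (ltnW (ltn_ord (q a)))).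
by rewrite sum1_card card_ord.
Qed.

Lemma standardization_eq (u : seq nat) : size u = m ->
  (standardization u == one_line p) =
  [forall a : 'I_m, forall b : 'I_m, (nth 0 u a < nth 0 u b) == (p a < p b)].
Proof.
move=> su.
have mem_u (a : 'I_m) : nth 0 u a \in u by rewrite mem_nth // su.
have nth_std (a : 'I_m) :
    nth 0 (standardization u) a = (index (nth 0 u a) (sort leq u)).+1.
  by rewrite /standardization (nth_map 0) // su.
have idx_lt (a : 'I_m) : index (nth 0 u a) (sort leq u) < m.
  by rewrite -[m in _ < m]su -(size_sort leq) index_mem mem_sort.
apply/eqP/forallP => [E a|H].
  apply/forallP => b; rewrite -(ltn_index_sort (mem_u a) (mem_u b)) -ltnS.
  by rewrite -!nth_std E !nth_one_line ltnS.
pose q (a : 'I_m) : 'I_m := Ordinal (idx_lt a).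
have q_lt a b : (q a < q b) = (p a < p b).
  by rewrite /q /= ltn_index_sort //; move/forallP/(_ b)/eqP: (H a).
have q_inj : injective q.
  move=> a b E; apply: (@perm_inj _ p); apply: val_inj => /=.
  by have := q_lt a b; have := q_lt b a; rewrite E ltnn; case: ltngtP.
have qp a : q a = p a.
  apply: val_inj; rewrite /= -[RHS]card_below_perm.
  have := card_below_perm (perm q_inj) a; rewrite permE /= => {1}<-.
  by apply: eq_card => b; rewrite !inE !permE q_lt.
apply: (@eq_from_nth _ 0) => [|i]; first by rewrite size_map su size_one_line.
rewrite size_map su => im; rewrite -[i]/(val (Ordinal im)) nth_std nth_one_line.
by rewrite -qp.
Qed.

Lemma occurs_atE n (s : 'S_n) i : occurs_at p s i = occ p (one_line s) i.
Proof.
rewrite /occurs_at /occ /one_line size_image card_ord -/(one_line s).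
case im: (i + m <= n) => //=.
rewrite standardization_eq; last first.
  rewrite size_takel // size_drop /one_line size_image card_ord; lia.
apply: eq_forallb => a; apply: eq_forallb => b.
by rewrite !nth_take // !nth_drop.
Qed.

Lemma occurrencesE n (s : 'S_n) : occurrences p s = occ_count p (one_line s).
Proof.
rewrite /occurrences /occ_count /one_line size_image card_ord -/(one_line s).
rewrite -sum1dep_card -sum1_count big_mkcond /=.
rewrite (_ : iota 0 n = index_iota 0 n); last by rewrite /index_iota subn0.
rewrite [RHS]big_mkcond big_mkord; apply: eq_bigr => i _.
by rewrite occurs_atE.
Qed.

End Standardization.

Section Injective.

Variables (n M : nat).

Definition word_of (f : {ffun 'I_n -> 'I_M}) : seq nat :=
  [seq val (f i) | i <- enum 'I_n].

Lemma nth_word_of f (i : 'I_n) : nth 0 (word_of f) i = f i.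
Proof. by rewrite /word_of (nth_map i) ?size_enum_ord // nth_ord_enum. Qed.

Lemma size_word_of f : size (word_of f) = n.
Proof. by rewrite size_map size_enum_ord. Qed.

Lemma word_of_inj : injective word_of.
Proof.
move=> f g E; apply/ffunP => i; apply: val_inj => /=.
by rewrite -!nth_word_of E.
Qed.

Lemma uniq_word_of f : uniq (word_of f) = injectiveb f.
Proof.
apply/idP/injectiveP => [uf i j E|inj_f]; last first.
  by rewrite map_inj_uniq ?enum_uniq // => i j /val_inj; apply: inj_f.
have H := @nth_uniq _ 0 (word_of f) i j.
rewrite !size_word_of !nth_word_of E eqxx in H.
by apply/val_inj/eqP; rewrite -(H (ltn_ord i) (ltn_ord j) uf).
Qed.

Lemma mem_word_of w :
  (w \in words (iota 0 M) n) = (w \in [seq word_of f | f : {ffun 'I_n -> 'I_M}]).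
Proof.
rewrite mem_words; apply/andP/mapP => [[/eqP sw /allP aw]|[f _ ->]].
  have lt_w (i : 'I_n) : nth 0 w i < M.
    have /aw : nth 0 w i \in w by rewrite mem_nth // sw.
    by rewrite /= mem_iota add0n.
  exists [ffun i => Ordinal (lt_w i)]; first by rewrite mem_enum.
  apply: (@eq_from_nth _ 0); rewrite ?size_word_of // sw => i i_n.
  by rewrite -[i]/(val (Ordinal i_n)) nth_word_of ffunE.
rewrite size_word_of; split=> //; apply/allP => _ /mapP[i _ ->] /=.
by rewrite mem_iota /=.
Qed.

Lemma sum_uniq_words (F : seq nat -> nat) :
  \sum_(w <- words (iota 0 M) n | uniq w) F w =
  \sum_(f : {ffun 'I_n -> 'I_M} | injectiveb f) F (word_of f).
Proof.
rewrite (perm_big [seq word_of f | f : {ffun 'I_n -> 'I_M}]); last first.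
  apply: uniq_perm; first by apply: words_uniq; apply: iota_uniq.
    by rewrite map_inj_uniq ?enum_uniq //; exact: word_of_inj.
  by move=> w; rewrite mem_word_of.
rewrite /image_mem big_map big_enum_cond /=; apply: eq_bigl => f.
by rewrite uniq_word_of.
Qed.

Lemma rank_perm (f : {ffun 'I_n -> 'I_M}) : injective f ->
  exists r : 'S_n, forall i j, (f i < f j) = (r i < r j).
Proof.
move=> inj_f.
have lt_r i : #|[set j | f j < f i]| < n.
  rewrite -[n in _ < n]card_ord -cardsT; apply: proper_card.
  by apply/properP; split; [exact: subsetT|exists i; rewrite ?inE ?ltnn].
pose r i := Ordinal (lt_r i).
have mono i j : f i < f j -> r i < r j.
  move=> ij; apply: proper_card; apply/properP; split.
    by apply/subsetP => l; rewrite !inE => /ltn_trans; apply.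
  by exists i; rewrite !inE ?ltnn.
have r_lt i j : (f i < f j) = (r i < r j).
  apply/idP/idP => [/mono //|rij]; rewrite ltnNge leq_eqVlt negb_or.
  apply/andP; split.
    by apply: contraL rij => /eqP/val_inj/inj_f ->; rewrite ltnn.
  by apply: contraL rij => /mono; rewrite -leqNgt; apply: ltnW.
have r_inj : injective r.
  move=> i j E; apply: inj_f; apply: val_inj => /=.
  by have := r_lt i j; have := r_lt j i; rewrite E ltnn; case: ltngtP.
by exists (perm r_inj) => i j; rewrite !permE.
Qed.

Lemma eq_occ_count m (p : 'S_m) (w v : seq nat) : size w = n -> size v = n ->
  (forall i j : 'I_n, (nth 0 w i < nth 0 w j) = (nth 0 v i < nth 0 v j)) ->
  occ_count p w = occ_count p v.
Proof.
move=> sw sv H; rewrite /occ_count sw sv; apply: eq_in_count => i _.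
rewrite /occ sw sv; case im: (i + m <= n) => //=.
apply: eq_forallb => a; apply: eq_forallb => b.
have ha : i + a < n by have := ltn_ord a; lia.
have hb : i + b < n by have := ltn_ord b; lia.
by rewrite -[i + a]/(val (Ordinal ha)) -[i + b]/(val (Ordinal hb)) H.
Qed.

(** The positions of an injective word can be permuted so that it becomes order
    isomorphic to any given permutation, in one way for each.  Averaging over
    all rearrangements therefore replaces injective words by permutations. *)
Lemma sum_injective m (p : 'S_m) (h : nat -> nat) :
  n`! * \sum_(f : {ffun 'I_n -> 'I_M} | injectiveb f) h (occ_count p (word_of f)) =
  #|[pred f : {ffun 'I_n -> 'I_M} | injectiveb f]| *
    \sum_(s : 'S_n) h (occurrences p s).
Proof.
pose comp (g : 'S_n) (f : {ffun 'I_n -> 'I_M}) := [ffun i => f (g i)].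
have comp_inj g : injective (comp g).
  move=> f1 f2 /ffunP E; apply/ffunP => i.
  by have := E ((g^-1)%g i); rewrite !ffunE permKV.
have comp_injb g f : injectiveb (comp g f) = injectiveb f.
  apply/injectiveP/injectiveP => inj i j E.
    have := inj ((g^-1)%g i) ((g^-1)%g j); rewrite !ffunE !permKV => /(_ E).
    exact: perm_inj.
  by apply: (@perm_inj _ g); apply: inj; move: E; rewrite !ffunE.
transitivity (\sum_(g : 'S_n) \sum_(f : {ffun 'I_n -> 'I_M} | injectiveb f)
                 h (occ_count p (word_of (comp g f)))).
  rewrite -{1}(card_Sn n) -sum1_card big_distrl /=; apply: eq_bigr => g _.
  rewrite mul1n (reindex_inj (comp_inj g)); apply: eq_bigl => f.
  by rewrite comp_injb.
rewrite exchange_big /= -sum1_card big_distrl /=.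
apply: eq_big => // f /injectiveP inj_f; rewrite mul1n.
have [r r_lt] := rank_perm inj_f.
rewrite [RHS](reindex_inj (mulIg r)) /=; apply: eq_bigr => g _.
rewrite occurrencesE; congr (h _); apply: eq_occ_count.
- exact: size_word_of.
- by rewrite size_one_line.
by move=> i j; rewrite !nth_word_of !nth_one_line !ffunE !permM ltnS r_lt.
Qed.

Lemma sum_occurrences m (p t : 'S_m) (h : nat -> nat) :
  strongly_c_wilf_equivalent p t ->
  \sum_(s : 'S_n) h (occurrences p s) = \sum_(s : 'S_n) h (occurrences t s).
Proof.
move=> eqv.
have E (q : 'S_m) : \sum_(s : 'S_n) h (occurrences q s) =
    \sum_(j < n.+1) #|[set s : 'S_n | occurrences q s == j]| * h j.
  have le_occ (s : 'S_n) : occurrences q s < n.+1.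
    by rewrite ltnS -[n in _ <= n]card_ord; apply: max_card.
  rewrite (partition_big (fun s => Ordinal (le_occ s)) xpredT) //=.
  apply: eq_bigr => j _; rewrite -sum1dep_card big_distrl /=.
  by apply: eq_big => [s|s /eqP <-]; rewrite ?mul1n.
by rewrite !E; apply: eq_bigr => j _; rewrite eqv.
Qed.

Lemma sum_uniq_occ_count m (p t : 'S_m) (h : nat -> nat) :
  strongly_c_wilf_equivalent p t ->
  \sum_(w <- words (iota 0 M) n | uniq w) h (occ_count p w) =
  \sum_(w <- words (iota 0 M) n | uniq w) h (occ_count t w).
Proof.
move=> eqv; apply/eqP; rewrite -(eqn_pmul2l (fact_gt0 n)); apply/eqP.
by rewrite !sum_uniq_words !sum_injective (sum_occurrences _ eqv).
Qed.

End Injective.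

(** * Equality of leading terms *)

(** Words of length n number M^n, so this relation is equality of the leading
    terms of two counts of words.  The factor M replaces the error exponent n - 1
    and keeps the relation meaningful for n = 0. *)
Definition close (n : nat) (f g : nat -> nat) : Prop :=
  exists C, forall M, M * f M <= M * g M + C * M ^ n /\
                      M * g M <= M * f M + C * M ^ n.

Lemma close_refl n f : close n f f.
Proof. by exists 0 => M; rewrite addn0. Qed.

Lemma close_ext n f f' g g' : f =1 f' -> g =1 g' -> close n f g -> close n f' g'.
Proof. by move=> Ef Eg [C H]; exists C => M; rewrite -Ef -Eg. Qed.

Lemma close_add n f f' g g' : close n f f' -> close n g g' ->
  close n (fun M => f M + g M) (fun M => f' M + g' M).
Proof.
move=> [C HC] [D HD]; exists (C + D) => M.
by have [] := HC M; have [] := HD M; rewrite mulnDl !mulnDr; lia.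
Qed.

Lemma close_sum n (I : Type) (r : seq I) (f g : I -> nat -> nat) :
  (forall i, close n (f i) (g i)) ->
  close n (fun M => \sum_(i <- r) f i M) (fun M => \sum_(i <- r) g i M).
Proof.
move=> H; elim: r => [|i r IHr].
  by apply: (close_ext _ _ (close_refl n (fun=> 0))) => M; rewrite big_nil.
by apply: (close_ext _ _ (close_add (H i) IHr)) => M; rewrite big_cons.
Qed.

(** Common leading terms can be cancelled; this isolates the unknown cluster
    count in the recursion. *)
Lemma close_addr n f f' g g' : close n g g' ->
  close n (fun M => f M + g M) (fun M => f' M + g' M) -> close n f f'.
Proof.
move=> [C HC] [D HD]; exists (C + D) => M.
by have [] := HC M; have [] := HD M; rewrite mulnDl !mulnDr; lia.
Qed.

Lemma close_mul a b f f' g g' A B : close a f f' -> close b g g' ->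
  (forall M, f M <= A * M ^ a) -> (forall M, f' M <= A * M ^ a) ->
  (forall M, g M <= B * M ^ b) -> (forall M, g' M <= B * M ^ b) ->
  close (a + b) (fun M => f M * g M) (fun M => f' M * g' M).
Proof.
have half u u' v v' U V s t C D M : M * u <= M * u' + C * s ->
    M * v <= M * v' + D * t -> u' <= U * s -> v <= V * t ->
    M * (u * v) <= M * (u' * v') + (C * V + U * D) * (s * t).
  move=> h1 h2 h3 h4.
  have e1 := leq_mul h1 (leqnn v); have e2 := leq_mul (leqnn u') h2.
  have e3 := leq_mul h3 (leqnn (D * t)); have e4 := leq_mul (leqnn (C * s)) h4.
  by rewrite !mulnDl !mulnDr in e1 e2 *; lia.
move=> [C HC] [D HD] fA fA' gB gB'; exists (C * B + A * D) => M.
have [C1 C2] := HC M; have [D1 D2] := HD M; rewrite expnD.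
by split; apply: half.
Qed.

Lemma bin_leq_exp2 n k : 'C(n, k) <= 2 ^ n.
Proof.
elim: n k => [|n IHn] [|k] //; first by rewrite bin0 expn_gt0.
by rewrite binS expnS mul2n -addnn leq_add.
Qed.

(** The error made when permutations are replaced by words is of lower order. *)
Lemma few_repeats n : exists C, forall M,
  M * \sum_(w <- words (iota 0 M) n) ~~ uniq w <= C * M ^ n.
Proof.
elim: n => [|n [C HC]]; first by exists 0 => M; rewrite sum_words0 muln0.
exists (n + C) => M; rewrite sum_wordsS.
have memb (w : seq nat) : \sum_(a <- iota 0 M) (a \in w) <= size w.
  rewrite (_ : \sum_(a <- iota 0 M) (a \in w : nat) = count (mem w) (iota 0 M)); last first.
    by rewrite -sum1_count [RHS]big_mkcond; apply: eq_bigr => a _; rewrite inE; case: (a \in w).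
  have -> : count (mem w) (iota 0 M) = size [seq a <- iota 0 M | a \in w].
    by rewrite size_filter.
  by apply: uniq_leq_size => [|a]; rewrite ?filter_uniq ?iota_uniq // mem_filter => /andP[].
have S1 : \sum_(a <- iota 0 M) \sum_(w <- words (iota 0 M) n) (a \in w) <= n * M ^ n.
  rewrite exchange_big /= -[X in X ^ _](size_iota 0) -size_words.
  rewrite -[size (words _ _)]sum1_size big_distrr /= big_seq [X in _ <= X]big_seq.
  by apply: leq_sum => w /size_in_words sw; rewrite muln1 -[X in _ <= X]sw memb.
have S2 : \sum_(a <- iota 0 M) \sum_(w <- words (iota 0 M) n) ~~ uniq w =
          M * \sum_(w <- words (iota 0 M) n) ~~ uniq w.
  by rewrite big_const_seq count_predT size_iota iter_addn_0 mulnC.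
apply: (@leq_trans (M * (n * M ^ n + C * M ^ n))); last by rewrite expnS; lia.
rewrite leq_mul2l; apply/orP; right.
apply: leq_trans (leq_add S1 (HC M)); rewrite -S2 -big_split /=.
apply: leq_sum => a _; rewrite -big_split /=; apply: leq_sum => w _.
by case: (a \in w) => //=; case: uniq.
Qed.

Section Equivalent.

Variables (m : nat) (p t : 'S_m).
Hypothesis eqv : strongly_c_wilf_equivalent p t.

(** Injective words contribute equally by equidistribution, and the remaining
    words are negligible. *)
Lemma marking_count_close n k :
  close n (fun M => marking_count p M n k) (fun M => marking_count t M n k).
Proof.
have [C HC] := few_repeats n; exists (2 ^ n * C) => M.
have split_total (q : 'S_m) : exists2 r, marking_count q M n k =
   \sum_(w <- words (iota 0 M) n | uniq w) 'C(occ_count q w, k) + r &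
   M * r <= 2 ^ n * C * M ^ n.
  exists (\sum_(w <- words (iota 0 M) n | ~~ uniq w) 'C(occ_count q w, k)).
    by rewrite /marking_count (bigID uniq).
  rewrite -mulnA; apply: leq_trans (leq_mul (leqnn (2 ^ n)) (HC M)).
  rewrite mulnCA leq_mul // big_distrr /= big_mkcond /= big_seq [X in _ <= X]big_seq.
  apply: leq_sum => w /size_in_words sw; case: uniq => //=; rewrite muln1.
  apply: leq_trans (bin_leq_exp2 _ _) _; rewrite leq_exp2l //.
  by rewrite /occ_count (leq_trans (count_size _ _)) // size_iota sw.
have [r -> hr] := split_total p; have [r' -> hr'] := split_total t.
by rewrite (sum_uniq_occ_count n M (fun i => 'C(i, k)) eqv) !mulnDr; lia.
Qed.

(** In the recursion the term of the full length n is the cluster count itself,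
    and all other terms involve shorter clusters: induction on n. *)
Lemma cluster_count_close n k : 0 < n ->
  close n (fun M => cluster_count p M n k) (fun M => cluster_count t M n k).
Proof.
elim/ltn_ind: n k => n IHn k n0.
pose rest (q : 'S_m) M := \sum_(1 <= c < n) \sum_(j < k.+1)
     cluster_count q M c j * marking_count q M (n - c) (k - j).
have E (q : 'S_m) M : marking_count q M n k = cluster_count q M n k + rest q M.
  rewrite marking_count_rec // big_nat_recr //= addnC; congr (_ + _).
  rewrite subnn (bigD1 ord_max) //= subnn marking_count0 muln1 big1 ?addn0 // => j.
  rewrite -val_eqE /= marking_count0 => jk; rewrite (_ : k - j == 0 = false) ?muln0 //.
  by have := ltn_ord j; lia.
apply: (@close_addr _ _ _ (rest p) (rest t)); last first.
  by apply: close_ext (marking_count_close n k) => M; rewrite E.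
rewrite /rest; apply: (@close_ext _
   (fun M => \sum_(c <- index_iota 1 n) if (1 <= c < n) then \sum_(j < k.+1)
     cluster_count p M c j * marking_count p M (n - c) (k - j) else 0) _
   (fun M => \sum_(c <- index_iota 1 n) if (1 <= c < n) then \sum_(j < k.+1)
     cluster_count t M c j * marking_count t M (n - c) (k - j) else 0)) => [M|M|].
- by rewrite [RHS]big_nat_cond [RHS]big_mkcond /=; apply: eq_bigr => c _; rewrite andbT.
- by rewrite [RHS]big_nat_cond [RHS]big_mkcond /=; apply: eq_bigr => c _; rewrite andbT.
apply: close_sum => c; case hc: (1 <= c < n); last exact: close_refl.
apply: close_sum => j; rewrite -[n in close n](subnKC (_ : c <= n)); last by lia.
apply: (@close_mul _ _ _ _ _ _ (2 ^ c) (2 ^ (n - c))) => [||M|M|M|M].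
- by apply: IHn; lia.
- exact: marking_count_close.
- exact: cluster_count_le.
- exact: cluster_count_le.
- exact: marking_count_le.
exact: marking_count_le.
Qed.

End Equivalent.

(** * Clusters with single-letter overlaps *)

Section Chain.

Variable (N : nat).
Hypothesis N0 : 0 < N.

(** Windows of length N + 1 starting at the first k multiples of N: each shares
    exactly one letter with the next. *)
Definition chain_marks k : bitseq :=
  mkseq (fun i => (N %| i) && (i < k * N)) (k * N).+1.

Lemma nth_chain_marks k i : nth false (chain_marks k) i = (N %| i) && (i < k * N).
Proof.
case: (ltnP i (k * N).+1) => h; first by rewrite nth_mkseq.
rewrite nth_default ?size_mkseq //; case: dvdn => //=; apply/esym/negbTE; lia.
Qed.

Lemma count_chain_marks k : count id (chain_marks k) = k.
Proof.
rewrite /chain_marks /mkseq count_map -addn1 iotaD count_cat /= ltnn andbF !addn0.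
have H := divn_count_dvd N (k * N); rewrite mulnK // big_add1 /= in H.
have /eqP := erefl (\sum_(0 <= i < (k * N).+1) (N %| i)).
rewrite {1}big_nat_recl // big_nat_recr //= dvdn0 dvdn_mull //.
rewrite -H.
rewrite addnC eqn_add2r => /eqP {H} H; rewrite [RHS]H -sum1_count.
rewrite (_ : iota 0 (k * N) = index_iota 0 (k * N)); last by rewrite /index_iota subn0.
rewrite big_mkcond /= [LHS]big_nat_cond [RHS]big_nat_cond; apply: eq_bigr => i.
by rewrite andbT => /andP[_ ->]; rewrite andbT; case: dvdn.
Qed.

Lemma cluster_chain_marks k : cluster N.+1 (chain_marks k).
Proof.
apply/clusterP; rewrite size_mkseq; split => // [|c /andP[c0 ck]].
  apply/fitsP => i; rewrite nth_chain_marks size_mkseq => /andP[/dvdnP[j ->]].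
  by rewrite ltn_pmul2r // addnS ltnS addnC -mulSn leq_mul2r => ->; rewrite orbT.
apply/negP => /cutP/(_ ((c.-1 %/ N) * N)); rewrite nth_chain_marks dvdn_mull //=.
have h := divn_eq c.-1 N; have h2 := ltn_pmod c.-1 N0.
have -> /= : c.-1 %/ N * N < k * N by lia.
by move=> /(_ isT); lia.
Qed.

(** A window of length N + 1 has N interior cut points, and there are k N cut
    points to destroy with k windows, so that no two windows may share one.  With
    P c the number of marks before c, this forces P c to be c / N rounded up. *)
Lemma cluster_chain_uniq k b : size b = (k * N).+1 -> count id b = k ->
  cluster N.+1 b -> b = chain_marks k.
Proof.
move=> sb cb /clusterP[_ _ nocut].
pose P c := count id (take c b).
have PS i : P i.+1 = P i + nth false b i.
  rewrite /P; case: (ltnP i (size b)) => h.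
    by rewrite (take_nth false h) -cats1 count_cat /= addn0.
  by rewrite nth_default // !take_oversize ?addn0 //; lia.
have Pmono i j : i <= j -> P i <= P j.
  move=> /subnKC <-; elim: (j - i) => [|l IHl]; first by rewrite addn0.
  by rewrite addnS PS; lia.
have P0 : P 0 = 0 by rewrite /P take0.
have Pend : P (k * N).+1 = k by rewrite /P -sb take_size.
have cover c : 0 < c <= k * N -> P (c - N) < P c.
  move=> hc; have := nocut c; rewrite sb ltnS hc => /(_ isT).
  rewrite /cut -has_predC => /hasP[i _ /=]; rewrite negb_imply => /andP[bi hi].
  have {hi} /andP[ci ic] : c - N <= i < c by lia.
  apply: leq_trans (Pmono i.+1 c ic).
  by rewrite PS bi addn1 ltnS Pmono.
have step r j : 0 < r -> r + j * N <= k * N -> P r + j <= P (r + j * N).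
  move=> r0; elim: j => [|j IHj] h; first by rewrite !addn0.
  have := cover (r + j.+1 * N); rewrite mulSn in h *.
  rewrite (_ : r + (N + j * N) - N = r + j * N); last by lia.
  by have := IHj; lia.
have Pval r j : 0 < r <= N -> j < k -> P (r + j * N) = j.+1.
  move=> /andP[r0 rN] jk; apply/eqP; rewrite eqn_leq; apply/andP; split.
    have := step (r + j * N) (k.-1 - j).
    rewrite -addnA -mulnDl subnKC; last by lia.
    have E : k.-1 * N + N = k * N by rewrite -mulSnr prednK //; lia.
    have := Pmono (r + k.-1 * N) (k * N).+1; rewrite Pend; lia.
  have := step r j r0; have := cover r.
  have : j * N + N <= k * N by rewrite -mulSnr leq_mul2r jk orbT.
  have -> : r - N = 0 by lia.
  rewrite P0; lia.
apply: (@eq_from_nth _ false) => [|i]; first by rewrite size_mkseq.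
rewrite sb ltnS => ik; rewrite nth_chain_marks; have := PS i.
case: (ltngtP i (k * N)) ik => // [ik _|-> _]; last first.
  rewrite Pend andbF; case: (k) Pval => [|k'] Pv; first by rewrite mul0n P0; case: nth.
  by rewrite mulSn Pv ?leqnn ?N0 //; case: nth; rewrite //= ; lia.
have Ei := divn_eq i N; have hi := ltn_pmod i N0.
set j := i %/ N in Ei *; set r := i %% N in Ei hi *.
have jk : j < k by rewrite /j ltn_divLR.
have P1 : P i.+1 = j.+1 by rewrite Ei -addnS addnC Pval.
have P2 : P i = j + (0 < r).
  rewrite Ei addnC; case: (posnP r) => r0; last by rewrite Pval ?r0 ?addn1 // ltnW.
  rewrite r0 addn0 add0n; case: (j) jk => [|j'] jk; first by rewrite mul0n P0.
  by rewrite mulSn Pval ?leqnn ?N0 //; lia.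
by rewrite andbT /dvdn -/r P1 P2; case: nth; lia.
Qed.

End Chain.

Lemma cluster_count_chain N (p : 'S_N.+1) M k : 0 < N ->
  cluster_count p M (k * N).+1 k = marked_count p M (chain_marks N k).
Proof.
move=> N0; rewrite /cluster_count.
have u : uniq (words bits (k * N).+1) by apply: words_uniq.
have mem_c : chain_marks N k \in words bits (k * N).+1.
  by rewrite mem_words size_mkseq eqxx; apply/allP => -[].
rewrite (bigD1_seq _ mem_c u) cluster_chain_marks // count_chain_marks // eqxx.
rewrite mul1n big1_seq; first exact: addn0.
move => b /andP[nb /size_in_words sb].
case cb: (cluster _ b && _); rewrite ?mul0n //.
case/andP: cb => cl /eqP cb; case/eqP: nb; exact: cluster_chain_uniq.
Qed.

(** * Chains of windows counted along their spine *)

(** Summing over the next lower letter of a strictly increasing sequence. *)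
Definition psum (f : nat -> nat) (v : nat) : nat := \sum_(0 <= u < v) f u.

(** The number of words of length k N + 1 over [0, M) that end with the letter v
    and in which k windows sharing single letters all follow the pattern.  Going
    through one more window, x letters are chosen below its first letter, d - 1
    between its ends, and y above its last letter. *)
Fixpoint spine (M x d y k v : nat) : nat :=
  if k is k'.+1 then
    'C(M.-1 - v, y) * iter d psum (fun u => 'C(u, x) * spine M x d y k' u) v
  else 1.

Definition chain_sum (M x d y k : nat) : nat := \sum_(0 <= v < M) spine M x d y k v.

Lemma eq_psum f g v : (forall u, u < v -> f u = g u) -> psum f v = psum g v.
Proof.
by move=> E; apply: eq_big_nat => u /andP[_ /E].
Qed.

Lemma psum_bin l v : psum (fun u => 'C(u, l)) v = 'C(v, l.+1).
Proof.
elim: v => [|v IHv]; first by rewrite /psum big_geq.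
by rewrite /psum big_nat_recr //= -/(psum _ v) IHv binS.
Qed.

Lemma iter_psum1 l v : iter l psum (fun=> 1) v = 'C(v, l).
Proof.
elim: l v => [|l IHl] v; first by rewrite bin0.
by rewrite -psum_bin; apply: eq_psum => u _; exact: IHl.
Qed.

Lemma sum_iota M (g : nat -> nat) :
  \sum_(a <- iota 0 M) g a = \sum_(0 <= a < M) g a.
Proof. by rewrite /index_iota subn0. Qed.

Lemma sum_below M v (g : nat -> nat) : v <= M ->
  \sum_(a <- iota 0 M) (a < v) * g a = psum g v.
Proof.
move=> vM; rewrite sum_iota /psum (big_nat_widen _ _ _ _ _ vM) [RHS]big_mkcond /=.
by apply: eq_bigr => a _; case: ltnP; rewrite ?mul1n.
Qed.

Lemma sum_above M v l : v < M ->
  \sum_(a <- iota 0 M) (v < a) * 'C(M.-1 - a, l) = 'C(M.-1 - v, l.+1).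
Proof.
move=> vM; rewrite sum_iota big_nat_rev /= add0n -psum_bin.
rewrite -(sum_below _ (_ : _ <= M)); last by lia.
rewrite -sum_iota; apply: eq_big_seq => a; rewrite mem_iota => /andP[_ aM].
by congr ((nat_of_bool _) * 'C(_, l)); lia.
Qed.

Section Increasing.

Variable M : nat.

(** Each of the l + 1 strict inequalities between u and v costs one partial
    sum. *)
Lemma sum_between (f : nat -> nat) l v : v <= M ->
  \sum_(u <- iota 0 M) f u *
     \sum_(c <- words (iota 0 M) l) path ltn u (rcons c v) =
  iter l.+1 psum f v.
Proof.
elim: l v => [|l IHl] v vM.
  rewrite iterS -(sum_below _ vM); apply: eq_bigr => u _.
  by rewrite sum_words0 /= andbT mulnC.
rewrite iterS -(sum_below _ vM).
transitivity (\sum_(u <- iota 0 M) \sum_(b <- iota 0 M) (b < v) * (f u *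
   \sum_(c <- words (iota 0 M) l) path ltn u (rcons c b))).
  apply: eq_bigr => u _; rewrite sum_words_rcons exchange_big /= big_distrr /=.
  apply: eq_bigr => b _; rewrite mulnCA; congr (_ * _); rewrite big_distrr /=.
  by apply: eq_bigr => c _; rewrite rcons_path last_rcons mulnb andbC.
rewrite exchange_big /=; apply: eq_big_seq => b; rewrite mem_iota => /andP[_ bM].
by rewrite -big_distrr /= -iterS -IHl //; lia.
Qed.

Lemma sum_sorted_below l u : u <= M ->
  \sum_(c <- words (iota 0 M) l) sorted ltn (rcons c u) = 'C(u, l).
Proof.
case: l => [|l] uM; first by rewrite sum_words0 bin0.
rewrite -iter_psum1 -(sum_between _ _ uM) sum_wordsS.
by apply: eq_bigr => a _; rewrite mul1n.
Qed.

Lemma sum_path_above l v : v < M ->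
  \sum_(c <- words (iota 0 M) l) path ltn v c = 'C(M.-1 - v, l).
Proof.
elim: l v => [|l IHl] v vM; first by rewrite sum_words0 bin0.
rewrite -sum_above // sum_wordsS; apply: eq_big_seq => a.
rewrite mem_iota add0n => /andP[_ aM]; rewrite -IHl // big_distrr /=.
by apply: eq_bigr => c _; rewrite mulnb.
Qed.

Lemma sum_increasing_words (f : nat -> nat) x d y v : v < M ->
  \sum_(c <- words (iota 0 M) (x + (d.+1 + y).+1))
     sorted ltn c * ((nth 0 c (x + d.+1) == v) * f (nth 0 c x)) =
  'C(M.-1 - v, y) * iter d.+1 psum (fun u => 'C(u, x) * f u) v.
Proof.
move=> vM; rewrite -(sum_between _ _ (ltnW vM)) -sum_path_above // sum_words_cat.
transitivity (\sum_(c1 <- words (iota 0 M) x) \sum_(u <- iota 0 M)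
  \sum_(c2 <- words (iota 0 M) d) \sum_(c3 <- words (iota 0 M) y)
   sorted ltn (rcons c1 u) * path ltn u (rcons c2 v) * path ltn v c3 * f u).
  apply: eq_big_seq => c1 /size_in_words s1; rewrite sum_wordsS.
  apply: eq_bigr => u _; rewrite addSnnS sum_words_cat.
  apply: eq_big_seq => c2 /size_in_words s2.
  rewrite sum_wordsS exchange_big /=; apply: eq_bigr => c3 _.
  have vI : v \in iota 0 M by rewrite mem_iota.
  rewrite (bigD1_seq v vI (iota_uniq 0 M)) /= big1 ?addn0 => [|b /negbTE bv].
    rewrite !nth_cat s1 ltnn subnn ltnNge leq_addr /= addKn /= nth_cat s2 ltnn subnn.
    rewrite /= eqxx mul1n; congr (_ * f u); rewrite !mulnb; congr nat_of_bool.
    rewrite -!cat_rcons; case: c1 {s1} => [|a c1] /=.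
      by rewrite cat_path last_rcons.
    by rewrite !cat_path !last_rcons andbA.
  by rewrite !nth_cat s1 ltnNge leq_addr /= addKn /= nth_cat s2 ltnn subnn /= bv muln0.
rewrite exchange_big /= big_distrr /=; apply: eq_big_seq => u.
rewrite mem_iota add0n => /andP[_ uM]; rewrite -sum_sorted_below; last exact: ltnW.
transitivity (\sum_(c1 <- words (iota 0 M) x) sorted ltn (rcons c1 u) * (f u *
  ((\sum_(c2 <- words (iota 0 M) d) path ltn u (rcons c2 v)) *
   (\sum_(c3 <- words (iota 0 M) y) path ltn v c3)))); last first.
  by rewrite -big_distrl /=; ring.
apply: eq_bigr => c1 _; rewrite big_distrlr !big_distrr /=; apply: eq_bigr => c2 _.
by rewrite !big_distrr /=; apply: eq_bigr => c3 _; ring.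
Qed.

End Increasing.

Section Pattern.

Variables (N : nat) (p : 'S_N.+1).

(** Puts the letters of an increasing word in the order of the pattern: the
    inverse of sorting an occurrence. *)
Definition arrange (c : seq nat) : seq nat :=
  [seq nth 0 c (p i) | i <- enum 'I_N.+1].

Lemma size_arrange c : size (arrange c) = N.+1.
Proof. by rewrite size_map size_enum_ord. Qed.

Lemma nth_arrange c (i : 'I_N.+1) : nth 0 (arrange c) i = nth 0 c (p i).
Proof. by rewrite /arrange (nth_map i) ?size_enum_ord // nth_ord_enum. Qed.

Lemma arrange_words M :
  perm_eq (words (iota 0 M) N.+1) [seq arrange c | c <- words (iota 0 M) N.+1].
Proof.
have uw : uniq (words (iota 0 M) N.+1) by apply/words_uniq/iota_uniq.
have inj : {in words (iota 0 M) N.+1 &, injective arrange}.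
  move=> c1 c2 /size_in_words s1 /size_in_words s2 E.
  apply: (@eq_from_nth _ 0) => [|i]; rewrite s1 ?s2 // => iN.
  have := congr1 (fun s => nth 0 s ((p^-1)%g (Ordinal iN))) E.
  by rewrite !nth_arrange permKV.
have sub : {subset [seq arrange c | c <- words (iota 0 M) N.+1]
            <= words (iota 0 M) N.+1}.
  move=> _ /mapP[c cw ->]; rewrite mem_words size_arrange eqxx /=.
  move: cw; rewrite mem_words => /andP[/eqP sc /allP ac].
  by apply/allP => _ /mapP[i _ ->]; apply: ac; rewrite mem_nth ?sc.
have um : uniq [seq arrange c | c <- words (iota 0 M) N.+1].
  by rewrite map_inj_in_uniq.
rewrite perm_sym; apply: uniq_perm => //.
by apply: (uniq_min_size um sub _).2; rewrite size_map.
Qed.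

Lemma occ_arrange c : size c = N.+1 -> occ p (arrange c) 0 = sorted ltn c.
Proof.
move=> sc; have sN : sorted ltn c =
    [forall a : 'I_N.+1, forall b : 'I_N.+1, (nth 0 c a < nth 0 c b) == (a < b)].
  apply/idP/forallP => [sl a|H].
    apply/forallP => b; apply/eqP; apply/idP/idP => [|ab].
      apply: contraTT; rewrite -!leqNgt leq_eqVlt => /orP[/eqP/val_inj -> //|ba].
      by apply: ltnW; apply: (sorted_ltn_nth ltn_trans) => //; rewrite inE sc.
    by apply: (sorted_ltn_nth ltn_trans) => //; rewrite inE sc.
  apply/(sortedP 0) => i; rewrite sc => iN.
  have /forallP/(_ (Ordinal iN))/eqP := H (Ordinal (ltnW iN)).
  by rewrite /= ltnSn.
rewrite sN /occ size_arrange leqnn /=; apply/forallP/forallP => H a.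
  apply/forallP => b; have /forallP/(_ ((p^-1)%g b)) := H ((p^-1)%g a).
  by rewrite !add0n !nth_arrange !permKV.
apply/forallP => b; have /forallP/(_ (p b)) := H (p a).
by rewrite !add0n !nth_arrange.
Qed.

Variables (x d y : nat).
Hypotheses (p_first : p ord0 = x :> nat) (p_last : p ord_max = x + d.+1 :> nat)
  (sum_N : N = x + d.+1 + y).

(** Sorting the letters of a window turns it into an increasing word, in which
    the first letter of the window has rank x and the last one rank x + d + 1,
    so only these two ranks matter. *)
Lemma sum_window M (f : nat -> nat) v : v < M ->
  \sum_(a <- iota 0 M) f a *
     \sum_(w <- words (iota 0 M) N.-1) occ p (a :: rcons w v) 0 =
  'C(M.-1 - v, y) * iter d.+1 psum (fun u => 'C(u, x) * f u) v.
Proof.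
move=> vM; rewrite -sum_increasing_words //.
have -> : x + (d.+1 + y).+1 = N.+1 by rewrite sum_N; lia.
transitivity (\sum_(w <- words (iota 0 M) N.+1)
   occ p w 0 * ((nth 0 w N == v) * f (nth 0 w 0))).
  rewrite sum_wordsS; apply: eq_bigr => a _.
  have -> : words (iota 0 M) N = words (iota 0 M) N.-1.+1 by congr words; lia.
  rewrite sum_words_rcons big_distrr /=; apply: eq_big_seq => w /size_in_words sw.
  have vI : v \in iota 0 M by rewrite mem_iota.
  have last_w b : nth 0 (a :: rcons w b) N = b.
    have -> : N = N.-1.+1 by lia.
    by rewrite /= nth_rcons sw ltnn eqxx.
  rewrite (bigD1_seq v vI (iota_uniq 0 M)) big1 => [|b /negbTE bv] /=.
    by rewrite last_w eqxx mul1n addn0 mulnC.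
  by rewrite last_w bv muln0.
rewrite (perm_big _ (arrange_words M)) big_map.
apply: eq_big_seq => c /size_in_words sc; rewrite occ_arrange //.
by rewrite (nth_arrange c ord_max) (nth_arrange c ord0) p_first p_last.
Qed.

Definition chained k w := all (fun j => occ p w (j * N)) (iota 0 k).

Lemma N_gt0 : 0 < N. Proof. lia. Qed.

Lemma marked_chain k w : marked p (chain_marks N k) w = chained k w.
Proof.
apply/markedP/allP => [H j|H i].
  rewrite mem_iota => /andP[_ jk]; apply: H.
  by rewrite (nth_chain_marks N_gt0) dvdn_mull // ltn_pmul2r // N_gt0.
rewrite (nth_chain_marks N_gt0) => /andP[/dvdnP[j ->]]; rewrite ltn_pmul2r ?N_gt0 // => jk.
by apply: H; rewrite mem_iota.
Qed.

Lemma sum_chained M k v : v < M ->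
  \sum_(w <- words (iota 0 M) (k * N)) chained k (rcons w v) = spine M x d.+1 y k v.
Proof.
elim: k v => [|k IHk] v vM; first by rewrite sum_words0.
rewrite [RHS]/= -sum_window //.
  rewrite (_ : k.+1 * N = (k * N).+1 + N.-1); last by rewrite mulSn; lia.
rewrite sum_words_cat sum_words_rcons exchange_big /=.
apply: eq_big_seq => a; rewrite mem_iota add0n => /andP[_ aM].
rewrite -IHk // big_distrl /=; apply: eq_big_seq => w1 /size_in_words s1.
rewrite big_distrr /=; apply: eq_bigr => w2 _; rewrite mulnb; congr nat_of_bool.
rewrite /chained -[k.+1]addn1 iotaD all_cat rcons_cat /= andbT; congr (_ && _).
  apply: eq_in_all => j; rewrite mem_iota => /andP[_ jk].
  rewrite occ_catl // size_rcons s1 addnS ltnS -mulSnr leq_mul2r.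
  by move: jk; rewrite add0n => ->; rewrite orbT.
by rewrite cat_rcons add0n -[k * N]addn0 -s1 occ_catr.
Qed.

Lemma marked_count_chain M k :
  marked_count p M (chain_marks N k) = chain_sum M x d.+1 y k.
Proof.
rewrite /marked_count size_mkseq sum_words_rcons exchange_big /= /chain_sum -sum_iota.
apply: eq_big_seq => v; rewrite mem_iota add0n => /andP[_ vM].
by rewrite -sum_chained //; apply: eq_bigr => w _; rewrite marked_chain.
Qed.

End Pattern.

(** * The difference of the end values *)

Lemma leq_psum f g v : (forall u, u < v -> f u <= g u) -> psum f v <= psum g v.
Proof.
move=> H; rewrite /psum big_nat_cond [X in _ <= X]big_nat_cond.
by apply: leq_sum => u /andP[/andP[_ /H]].
Qed.

Lemma psum_bin_from Q l v g K :
  (forall u, Q <= u < v -> K * 'C(u - Q, l) <= g u) ->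
  K * 'C(v - Q, l.+1) <= psum g v.
Proof.
move=> H; elim: v H => [|v IHv] H; first by rewrite muln0.
rewrite /psum big_nat_recr //= -/(psum g v).
have IH : K * 'C(v - Q, l.+1) <= psum g v by apply: IHv => u hu; apply: H; lia.
case: (leqP Q v) => Qv; last by rewrite (_ : v.+1 - Q = 0) ?muln0; lia.
by rewrite subSn // binS mulnDr leq_add //; apply: H; lia.
Qed.

(** Keep the whole spine in [Q, 2Q): at least Q letters are then available
    below and above each of its letters, and the hanging letters can be
    chosen freely among them. *)
Lemma spine_lower M Q x d y k v : 3 * Q <= M -> Q <= v < 2 * Q ->
  ('C(Q, x) * 'C(Q, y)) ^ k * 'C(v - Q, k * d) <= spine M x d y k v.
Proof.
move=> QM; elim: k v => [|k IHk] v hv; first by rewrite mul1n bin0.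
have H r u : Q <= u < 2 * Q ->
  'C(Q, x) * ('C(Q, x) * 'C(Q, y)) ^ k * 'C(u - Q, r + k * d) <=
  iter r psum (fun w => 'C(w, x) * spine M x d y k w) u.
  elim: r u => [|r IHr] u hu.
    by rewrite -mulnA leq_mul ?IHk // leq_bin2l //; lia.
  by rewrite addSn; apply: psum_bin_from => w hw; apply: IHr; lia.
rewrite [X in X <= _](_ : _ = 'C(Q, y) *
  ('C(Q, x) * ('C(Q, x) * 'C(Q, y)) ^ k * 'C(v - Q, d + k * d))); last first.
  by rewrite expnS mulSn; ring.
by rewrite leq_mul ?H // leq_bin2l //; lia.
Qed.

Lemma chain_sum_lower_bin M Q x d y k : 3 * Q <= M ->
  ('C(Q, x) * 'C(Q, y)) ^ k * 'C(Q, (k * d).+1) <= chain_sum M x d y k.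
Proof.
move=> QM; rewrite -[in 'C(Q, (k * d).+1)](_ : 2 * Q - Q = Q); last by lia.
apply: leq_trans (_ : psum (spine M x d y k) (2 * Q) <= _).
  apply: psum_bin_from => u hu.
  by apply: spine_lower.
rewrite /chain_sum /psum [X in _ <= X](@big_cat_nat _ _ _ (2 * Q)) //=; last by lia.
exact: leq_addr.
Qed.

Lemma exp_leq_bin j Q : 2 * j <= Q -> Q ^ j <= 2 ^ j * j`! * 'C(Q, j).
Proof.
rewrite -mulnA [j`! * _]mulnC bin_ffact => hQ.
elim: j hQ => [|j IHj] hQ //.
rewrite !expnSr ffactnSr mulnACA leq_mul //; last by lia.
by apply: IHj; lia.
Qed.

Lemma bin_leq_exp u j : 'C(u, j) * j`! <= u ^ j.
Proof.
rewrite bin_ffact; elim: j => [|j IHj] //.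
by rewrite ffactnSr expnSr leq_mul // leq_subr.
Qed.

Lemma chain_sum_crude_lower x d y k M :
  6 * ((k * (x + d + y)).+1 + (x + d + y)) + 3 <= M ->
  M ^ (k * (x + d + y)).+1 <=
  12 ^ (k * (x + d + y)).+1 * ((x`! * y`!) ^ k * (k * d).+1`!) * chain_sum M x d y k.
Proof.
set n := (k * _).+1 => hM; pose Q := M %/ 3.
have hQ : 3 * Q <= M by rewrite /Q; lia.
have MQ : M <= 6 * Q by rewrite /Q; lia.
have Qn : 2 * (n + (x + d + y)) <= Q by rewrite /Q; lia.
have E : n = k * x + k * y + (k * d).+1 by rewrite /n !mulnDr; lia.
apply: leq_trans (_ : (6 * Q) ^ n <= _); first by rewrite leq_exp2r // /n.
apply: leq_trans (leq_mul (leqnn _) (chain_sum_lower_bin x d y k hQ)).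
have h1 : Q ^ x <= 2 ^ x * x`! * 'C(Q, x) by apply: exp_leq_bin; lia.
have h2 : Q ^ y <= 2 ^ y * y`! * 'C(Q, y) by apply: exp_leq_bin; lia.
have h3 : Q ^ (k * d).+1 <= 2 ^ (k * d).+1 * (k * d).+1`! * 'C(Q, (k * d).+1).
  by apply: exp_leq_bin; lia.
have powle a b : a <= b -> a ^ k <= b ^ k.
  by move=> ab; case: (k) => // k'; rewrite leq_exp2r.
have split2 a : a ^ n = (a ^ x) ^ k * (a ^ y) ^ k * a ^ (k * d).+1.
  by rewrite E !expnD -!expnM ![k * _]mulnC.
have := leq_mul (leqnn (6 ^ n)) (leq_mul (leq_mul (powle _ _ h1) (powle _ _ h2)) h3).
rewrite -split2 -expnMn => /leq_trans; apply; apply: eq_leq.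
rewrite (_ : 12 ^ n = 6 ^ n * 2 ^ n); last by rewrite -expnMn.
by rewrite (split2 2) !expnMn; ring.
Qed.

(** How leading terms are told apart: f and g cannot be close when f <= g / 2
    for arbitrarily large M and g has order at least M^n. *)
Lemma close_contradiction n f g c M1 : close n f g ->
  (forall M, M1 <= M -> M ^ n <= c * g M) ->
  (forall B, exists2 M, B <= M & 2 * f M <= g M) -> False.
Proof.
move=> [C HC] lower H; have [M hM fg] := H (2 * C * c + M1).+1.
have [_ h] := HC M; have := lower M; rewrite (_ : M1 <= M); last by lia.
move=> /(_ isT) lg.
have M0 : 0 < M ^ n by rewrite expn_gt0; lia.
have g0 : 0 < g M by case: (g M) lg => //; rewrite muln0; lia.
have : M * g M <= 2 * C * c * g M.
  have := leq_mul (leqnn C) lg; have := leq_mul (leqnn M) fg.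
  rewrite -!mulnA ![M * (2 * _)]mulnCA; lia.
by rewrite leq_pmul2r //; lia.
Qed.

Lemma spine_upper M x d y k v : v <= M ->
  spine M x d y k v <= (M ^ (x + y)) ^ k * 'C(v, k * d).
Proof.
elim: k v => [|k IHk] v vM; first by rewrite bin0.
have bin_le u j : u <= M -> 'C(u, j) <= M ^ j.
  move=> uM; apply: leq_trans (_ : u ^ j <= _); last first.
    by case: j => // j; rewrite leq_exp2r.
  apply: leq_trans (bin_leq_exp u j); exact: leq_pmulr (fact_gt0 j).
have H r u : u <= M ->
  iter r psum (fun w => 'C(w, x) * spine M x d y k w) u <=
  M ^ x * (M ^ (x + y)) ^ k * 'C(u, r + k * d).
  elim: r u => [|r IHr] u uM; first by rewrite -mulnA leq_mul ?IHk ?bin_le.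
  rewrite addSn -psum_bin /psum big_distrr /=.
  by apply: leq_psum => w wu; apply: IHr; lia.
rewrite /= expnS {1}expnD mulSn.
apply: leq_trans (leq_mul (bin_le _ y _) (H d v vM)) _; first by lia.
by apply: eq_leq; ring.
Qed.

Lemma chain_sum_crude_upper M x d y k :
  chain_sum M x d y k * (k * d).+1`! <= M ^ (k * (x + d + y)).+1.
Proof.
apply: (@leq_trans ((M ^ (x + y)) ^ k * 'C(M, (k * d).+1) * (k * d).+1`!)).
  rewrite leq_mul // -psum_bin /psum big_distrr /=.
  by apply: leq_psum => v vM; apply: spine_upper; exact: ltnW.
rewrite -mulnA; apply: leq_trans (leq_mul (leqnn _) (bin_leq_exp _ _)) _.
by rewrite -expnM -expnD leq_eqVlt; apply/orP; left; apply/eqP; congr (_ ^ _); ring.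
Qed.

Lemma fact_dominates A E : exists k, A * E ^ k <= k`!.
Proof.
case: E => [|E]; first by exists A.+1; rewrite exp0n // muln0.
set e := E.+1; pose j := A * e ^ (2 * e); exists (2 * e + j).
have H i : (2 * e) ^ i <= (2 * e + i)`!.
  elim: i => [|i IHi]; first by rewrite addn0 fact_gt0.
  by rewrite addnS factS expnS leq_mul //; lia.
apply: leq_trans (H j); rewrite expnMn expnD mulnA leq_mul //.
by apply: ltnW; apply: ltn_expl.
Qed.

Lemma fact_mul_leq a b : a`! * b`! <= (a + b)`!.
Proof.
elim: b => [|b IHb]; first by rewrite muln1 addn0.
by rewrite addnS !factS mulnCA leq_mul //; lia.
Qed.

Lemma close_sym n f g : close n f g -> close n g f.
Proof. by move=> [C HC]; exists C => M; have [] := HC M. Qed.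

(** Both counts are M^n / (kd + 1)! up to factors exponential in k, and for
    d < d' the quotient (kd' + 1)! / (kd + 1)! is at least k!, which outgrows
    every exponential. *)
Lemma close_same_gap x d y x' d' y' : x + d + y = x' + d' + y' ->
  (forall k, close (k * (x + d + y)).+1
     (fun M => chain_sum M x d y k) (fun M => chain_sum M x' d' y' k)) ->
  d' <= d.
Proof.
move=> sumE Hc; rewrite leqNgt; apply/negP => dd'.
set N := x + d + y in sumE Hc *.
(* 12^n with n = k N + 1 leaves one factor 12 outside the k-th power; the
   factor 2 is the one asked for by close_contradiction. *)
have [k hk] := fact_dominates (2 * 12) (12 ^ N * (x`! * y`!)).
pose n := (k * N).+1; pose c := 12 ^ n * ((x`! * y`!) ^ k * (k * d).+1`!).
apply: (@close_contradiction n (fun M => chain_sum M x' d' y' k)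
  (fun M => chain_sum M x d y k) c (6 * (n + N) + 3)); first exact/close_sym/Hc.
  by move=> M hM; apply: chain_sum_crude_lower.
move=> B; exists (B + (6 * (n + N) + 3)); first exact: leq_addr.
set M := B + _.
have lo : M ^ n <= c * chain_sum M x d y k.
  by apply: chain_sum_crude_lower; rewrite /M leq_addl.
have up : chain_sum M x' d' y' k * (k * d').+1`! <= M ^ n.
  by rewrite /n sumE; apply: chain_sum_crude_upper.
have c0 : 0 < c by rewrite /c !muln_gt0 !expn_gt0 muln_gt0 !fact_gt0.
have cd : 2 * c <= (k * d').+1`!.
  apply: leq_trans (_ : (k * d).+1`! * k`! <= _); last first.
    apply: leq_trans (fact_mul_leq _ _) _; apply: leq_fact; nia.
  apply: leq_trans (leq_mul (leqnn _) hk).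
  by rewrite /c /n expnS [(12 ^ N * _) ^ k]expnMn -expnM [N * k]mulnC; apply: eq_leq; ring.
rewrite -(leq_pmul2l c0); apply: leq_trans lo; apply: leq_trans up.
by rewrite mulnA [c * 2]mulnC mulnC leq_mul.
Qed.

(** * Difference one *)

Lemma psum_vandermonde a b M :
  \sum_(0 <= u < M) 'C(u, a) * 'C(M.-1 - u, b) = 'C(M, (a + b).+1).
Proof.
elim: M b => [|M IHM] b; first by rewrite big_geq.
rewrite big_nat_recr //= subnn; case: b => [|b].
  rewrite bin0 muln1 addn0 -psum_bin /psum big_nat_recr //=; congr (_ + _).
  by apply: eq_bigr => u _; rewrite bin0 muln1.
rewrite bin0n muln0 addn0 addnS binS -IHM -addnS -IHM -big_split /=.
apply: eq_big_nat => u /andP[_ uM]; rewrite -mulnDr -binS; congr (_ * 'C(_, _)).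
lia.
Qed.

(** With two windows and d = 1 the spine has three letters; summing over the
    outer two leaves a sum over the shared letter. *)
Lemma spine_pair M x y :
  chain_sum M x 1 y 2 = \sum_(0 <= u < M)
    ('C(u, x) * 'C(u, x.+1)) * ('C(M.-1 - u, y) * 'C(M.-1 - u, y.+1)).
Proof.
transitivity (\sum_(v <- iota 0 M) \sum_(u <- iota 0 M) (u < v) *
   ('C(M.-1 - v, y) * ('C(u, x) * 'C(u, x.+1) * 'C(M.-1 - u, y)))).
  rewrite /chain_sum -sum_iota; apply: eq_big_seq => v.
  rewrite mem_iota add0n => /andP[_ vM].
  rewrite sum_below ?(ltnW vM) // /= /psum big_distrr /=; apply: eq_bigr => u _.
  rewrite -psum_bin /psum; congr (_ * _); rewrite -mulnA; congr (_ * _).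
  rewrite mulnC; congr (_ * _); apply: eq_bigr => w _; by rewrite muln1.
rewrite exchange_big /= sum_iota; apply: eq_big_nat => u /andP[_ uM].
rewrite -(sum_above _ uM) !big_distrr /=; apply: eq_bigr => v _.
ring.
Qed.

(** Together with bin_prod_upper: binom(u, x) binom(u, x + 1) has the leading
    term of binom(2x + 1, x) binom(u, 2x + 1), and sums of products of two such
    binomials are given by Vandermonde's identity. *)
Lemma bin_prod_lower u x :
  'C(x.*2.+1, x) * 'C(u, x.*2.+1) <= 'C(u, x) * 'C(u, x.+1).
Proof.
case: (leqP (x.*2.+1) u) => hu; last by rewrite (bin_small hu) muln0.
apply: (@leq_trans ('C(u, x) * 'C(u - x, x.+1))); last first.
  by rewrite leq_mul // leq_bin2l // leq_subr.
rewrite -(leq_pmul2r (_ : 0 < x`! * x.+1`! * (u - x.*2.+1)`!)); last first.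
  by rewrite !muln_gt0 !fact_gt0.
have b1 := bin_fact (_ : x <= x.*2.+1); have b2 := bin_fact hu.
have b3 := bin_fact (_ : x <= u); have b4 := bin_fact (_ : x.+1 <= u - x).
have e1 : x.*2.+1 - x = x.+1 by lia.
have e2 : u - x - x.+1 = u - x.*2.+1 by lia.
rewrite e1 in b1; rewrite e2 in b4.
apply: eq_leq.
transitivity (u`!).
  by rewrite -b2 -b1; [ring | lia].
by rewrite -b3 -?b4; [ring | lia | lia].
Qed.

Lemma exp_leq_ffact u j : u ^ j <= (u + j.-1) ^_ j.
Proof.
case: j => // j /=; elim: j => [|j IHj]; first by rewrite addn0 ffactn1.
by rewrite addnS ffactSS expnS leq_mul //; lia.
Qed.

Lemma bin_prod_upper u x :
  'C(u, x) * 'C(u, x.+1) <= 'C(x.*2.+1, x) * 'C(u + x.*2, x.*2.+1).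
Proof.
rewrite -(leq_pmul2r (_ : 0 < x`! * x.+1`!)); last by rewrite muln_gt0 !fact_gt0.
have b1 := bin_fact (_ : x <= x.*2.+1).
rewrite (_ : x.*2.+1 - x = x.+1) in b1; last by lia.
apply: (@leq_trans (u ^ x * u ^ x.+1)).
  by rewrite mulnACA leq_mul // bin_leq_exp.
rewrite -expnD addnS addnn; apply: leq_trans (exp_leq_ffact _ _) _.
by rewrite /= -bin_ffact -b1; [apply: eq_leq; ring | lia].
Qed.

Lemma chain_pair_lower M x y :
  'C(x.*2.+1, x) * 'C(y.*2.+1, y) * 'C(M, ((x + y).*2 + 3)) <= chain_sum M x 1 y 2.
Proof.
rewrite spine_pair (_ : _ + 3 = (x.*2.+1 + y.*2.+1).+1); last by lia.
rewrite -psum_vandermonde big_distrr /=; apply: leq_sum => u _.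
by rewrite mulnACA leq_mul // bin_prod_lower.
Qed.

Lemma chain_pair_upper M x y :
  chain_sum M x 1 y 2 <=
  'C(x.*2.+1, x) * 'C(y.*2.+1, y) * 'C(M + (x + y).*2, ((x + y).*2 + 3)).
Proof.
rewrite spine_pair (_ : _ + 3 = (x.*2.+1 + y.*2.+1).+1); last by lia.
rewrite -psum_vandermonde big_distrr /=.
rewrite (_ : M + (x + y).*2 = x.*2 + (M + y.*2)); last by lia.
rewrite [X in _ <= X](@big_cat_nat _ _ _ x.*2) //=; last by lia.
apply: leq_trans (leq_addl _ _).
have shift a K (g : nat -> nat) :
    \sum_(a <= i < a + K) g i = \sum_(0 <= i < K) g (i + a).
  by rewrite -{1}[a]add0n big_addn addKn.
rewrite shift.
rewrite [X in _ <= X](@big_cat_nat _ _ _ M) //=; last by lia.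
apply: leq_trans (leq_addr _ _).
rewrite big_nat_cond [X in _ <= X]big_nat_cond.
apply: leq_sum => u /andP[/andP[_ uM] _].
rewrite (_ : _ - (u + _) = M.-1 - u + y.*2); last by lia.
by rewrite [X in _ <= X]mulnACA leq_mul // bin_prod_upper.
Qed.

Lemma bin_shift_close n s : exists C, forall M,
  M * 'C(M + s, n) <= M * 'C(M, n) + C * M ^ n.
Proof.
elim: s => [|s [C HC]]; first by exists 0 => M; rewrite !addn0.
case: n HC => [|n] HC; first by exists 0 => M; rewrite !bin0 addn0.
exists (C + s.+1 ^ n) => M; rewrite addnS binS mulnDr mulnDl addnA leq_add //.
case: M => // M; rewrite expnS mulnCA leq_mul // -expnMn.
apply: leq_trans (_ : (M.+1 + s) ^ n <= _).
  apply: leq_trans (bin_leq_exp _ n); exact: leq_pmulr (fact_gt0 n).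
by case: n {HC} => // n; rewrite leq_exp2r //; lia.
Qed.

Lemma central_ratio x : 'C(x.+1.*2.+1, x.+1) * x.+2 = 'C(x.*2.+1, x) * (2 * (x.*2 + 3)).
Proof.
have b1 := bin_fact (_ : x <= x.*2.+1); have b2 := bin_fact (_ : x.+1 <= x.+1.*2.+1).
rewrite (_ : x.*2.+1 - x = x.+1) in b1; last by lia.
rewrite (_ : x.+1.*2.+1 - x.+1 = x.+2) in b2; last by lia.
apply/eqP; rewrite -(eqn_pmul2r (_ : 0 < x`! * x.+1`! * x.+1)); last first.
  by rewrite !muln_gt0 !fact_gt0.
apply/eqP; transitivity (x.+1.*2.+1`!).
  by rewrite -b2; [rewrite !factS; ring | lia].
rewrite (_ : x.+1.*2.+1 = x.*2.+3); last by lia.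
by rewrite (factS x.*2.+2) (factS x.*2.+1) -b1 -?addnn; [ring | lia].
Qed.

(** The quotient h(x + 1) / h(x) = 2 (2x + 3) / (x + 2) = 4 - 2 / (x + 2) of
    successive values of h(x) = binom(2x + 1, x) increases. *)
Lemma central_log_convex x z : x < z ->
  'C(x.+1.*2.+1, x.+1) * 'C(z.*2.+1, z) < 'C(x.*2.+1, x) * 'C(z.+1.*2.+1, z.+1).
Proof.
move=> xz; have cx := central_ratio x; have cz := central_ratio z.
have px : 0 < 'C(x.*2.+1, x) by rewrite bin_gt0; lia.
have pz : 0 < 'C(z.*2.+1, z) by rewrite bin_gt0; lia.
rewrite -(ltn_pmul2r (_ : 0 < x.+2 * z.+2)) //.
rewrite [X in X < _]mulnACA cx -[X in _ < X]mulnA [X in _ < _ * X](_ : _ =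
  x.+2 * ('C(z.+1.*2.+1, z.+1) * z.+2)); last by ring.
rewrite cz (_ : _ * _ * (_ * z.+2) = 'C(x.*2.+1, x) * 'C(z.*2.+1, z) *
  (2 * (x.*2 + 3) * z.+2)); last by ring.
rewrite (_ : _ * (x.+2 * _) = 'C(x.*2.+1, x) * 'C(z.*2.+1, z) *
  (x.+2 * (2 * (z.*2 + 3)))); last by ring.
by rewrite ltn_pmul2l ?muln_gt0 ?px //; nia.
Qed.

Lemma central_spread x y j : x + j.*2 < y.+1 -> 0 < j ->
  'C((x + j).*2.+1, x + j) * 'C((y - j).*2.+1, y - j) <
  'C(x.*2.+1, x) * 'C(y.*2.+1, y).
Proof.
elim: j => // j IHj hy _; have := @central_log_convex (x + j) (y - j.+1).
rewrite -addnS (_ : (y - j.+1).+1 = y - j); last by lia.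
move=> /(_ (_ : _)) H; apply: leq_trans (H _) _; first by lia.
case: j IHj {H} hy => [|j] IHj hy; first by rewrite addn0 subn0.
by apply: ltnW; apply: IHj; lia.
Qed.

(** The two leading coefficients are h(x) h(y) and h(x') h(y') over the same
    factorial, with h(x) = binom(2x + 1, x); log-convexity makes the first one
    larger if x < x'. *)
Lemma close_unit_gap x y x' y' : x + y = x' + y' -> x <= y -> x' <= y' ->
  close ((x + y).*2 + 3) (fun M => chain_sum M x 1 y 2)
                         (fun M => chain_sum M x' 1 y' 2) ->
  x' <= x.
Proof.
move=> sumE xy xy' [C HC]; rewrite leqNgt; apply/negP => xx'.
set n := _ + 3 in HC.
have lt_c : 'C(x'.*2.+1, x') * 'C(y'.*2.+1, y') < 'C(x.*2.+1, x) * 'C(y.*2.+1, y).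
  have -> : x' = x + (x' - x) by lia.
  have -> : y' = y - (x' - x) by lia.
  by apply: central_spread; lia.
move: lt_c; set c' := _ * _; set c := _ * _ => lt_c.
have [D HD] := bin_shift_close n (x + y).*2.
(* Beyond 2 n, M^n is at most 2^n n! binom(M, n); the other term is the bound on
   M that the comparison of the two leading coefficients implies. *)
pose M := (2 ^ n * n`! * (c' * D + C) + 2 * n).+1.
have [h _] := HC M; have hD := HD M.
have lo : c * 'C(M, n) <= chain_sum M x 1 y 2 by apply: chain_pair_lower.
have up : chain_sum M x' 1 y' 2 <= c' * 'C(M + (x + y).*2, n).
  by rewrite /n sumE; apply: chain_pair_upper.
have hM : M ^ n <= 2 ^ n * n`! * 'C(M, n) by apply: exp_leq_bin; rewrite /M; lia.
have B0 : 0 < 'C(M, n) by rewrite bin_gt0 /M; lia.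
have h1 : M * (c * 'C(M, n)) <= M * (c' * 'C(M, n)) + (c' * D + C) * M ^ n.
  have := leq_mul (leqnn M) lo; have := leq_mul (leqnn M) up.
  by have := leq_mul (leqnn c') hD; lia.
have h2 : M * (c' * 'C(M, n)) + M * 'C(M, n) <= M * (c * 'C(M, n)).
  by rewrite -mulnDr leq_mul // -mulSnr leq_mul.
have : M * 'C(M, n) <= (c' * D + C) * (2 ^ n * n`!) * 'C(M, n).
  by have := leq_mul (leqnn (c' * D + C)) hM; lia.
by rewrite leq_pmul2r // /M; lia.
Qed.

(** * Spines with monotone weights *)

Import Order.TTheory GRing.Theory Num.Theory.
Local Open Scope ring_scope.

Lemma psum_natr (f : nat -> nat) v :
  (psum f v)%:R = \sum_(0 <= u < v) (f u)%:R :> rat.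
Proof. by rewrite /psum natr_sum. Qed.

Lemma exprD_lower (g b : rat) j : 0 <= g -> 0 <= b ->
  g ^+ j.+1 + j.+1%:R * b * g ^+ j <= (g + b) ^+ j.+1.
Proof.
move=> g0 b0; elim: j => [|j IHj]; first by rewrite !expr1 expr0 mulr1 mul1r.
rewrite [X in _ <= X]exprS.
apply: le_trans (ler_wpM2l (addr_ge0 g0 b0) IHj).
have h : 0 <= b * (j.+1%:R * b * g ^+ j) by rewrite !mulr_ge0 ?exprn_ge0.
have E : j.+2%:R = j.+1%:R + 1 :> rat by rewrite -natr1.
rewrite !exprS E in h *; move: h; set t := g ^+ j; lra.
Qed.

Lemma exprB_upper (s t : rat) j : 0 <= s -> s <= t ->
  t ^+ j.+1 <= s ^+ j.+1 + j.+1%:R * (t - s) * t ^+ j.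
Proof.
move=> s0 st; have t0 : 0 <= t := le_trans s0 st.
elim: j => [|j IHj]; first by rewrite !expr1 expr0 mulr1 mul1r; lra.
rewrite [X in X <= _]exprS; apply: le_trans (ler_wpM2l t0 IHj) _.
have h : (t - s) * s ^+ j.+1 <= (t - s) * t ^+ j.+1.
  by rewrite ler_wpM2l ?subr_ge0 // lerXn2r.
have E : j.+2%:R = j.+1%:R + 1 :> rat by rewrite -natr1.
rewrite E [s ^+ j.+2]exprS [t ^+ j.+1 in X in _ <= X]exprS.
rewrite [t ^+ j.+1]exprS in h; move: h; set S := s ^+ j.+1; set U := t ^+ j; lra.
Qed.

(** In this section a stands for a d-th root of the lower weight and c for a
    d-th root of the upper weight of a spine letter.  Only one letter out of d
    carries the weights a^d and c^d; as a increases and c decreases, spreading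
    them evenly over the d letters changes the sum in a known direction. *)
Section Weights.

Variables (a c : nat -> rat).
Hypotheses (a_gt0 : forall u, 0 < a u) (c_gt0 : forall u, 0 < c u)
  (a_homo : forall u v, (u <= v)%N -> a u <= a v)
  (c_homo : forall u v, (u <= v)%N -> c v <= c u).

Lemma a_ge0 u : 0 <= a u. Proof. exact: ltW. Qed.

Lemma c_ge0 u : 0 <= c u. Proof. exact: ltW. Qed.

Lemma ac_ge0 u : 0 <= a u * c u.
Proof. by rewrite mulr_ge0 ?a_ge0 ?c_ge0. Qed.

Definition mass (l v : nat) : rat := \sum_(l <= u < v) a u * c u.

Lemma mass_ge0 l v : 0 <= mass l v.
Proof. by apply: sumr_ge0 => u _; rewrite mulr_ge0 ?a_ge0 ?c_ge0. Qed.

Lemma mass_cat l v w : (l <= v)%N -> (v <= w)%N -> mass l w = mass l v + mass v w.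
Proof. by move=> lv vw; rewrite {1}/mass (big_cat_nat lv vw). Qed.

Lemma mass_homo l v w : (l <= v <= w)%N -> mass l v <= mass l w.
Proof. by case/andP=> lv vw; rewrite (mass_cat lv vw) lerDl mass_ge0. Qed.

Lemma massS l v : (l <= v)%N -> mass l v.+1 = mass l v + a v * c v.
Proof. by move=> lv; rewrite /mass big_nat_recr. Qed.

(** The value that the iterated sum of j evenly weighted letters below v would
    have if sums were integrals. *)
Definition pow_mass j v : rat := mass 0 v ^+ j / j`!%:R.

Lemma pow_mass_ge0 j v : 0 <= pow_mass j v.
Proof. by rewrite divr_ge0 ?exprn_ge0 ?mass_ge0. Qed.

Lemma fact_neq0 j : j`!%:R != 0 :> rat.
Proof. by rewrite pnatr_eq0 -lt0n fact_gt0. Qed.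

Lemma sum_pow_mass j v :
  \sum_(0 <= u < v) a u * c u * pow_mass j u <= pow_mass j.+1 v.
Proof.
elim: v => [|v IHv]; first by rewrite big_geq // pow_mass_ge0.
rewrite big_nat_recr //=; apply: (@le_trans _ _ (pow_mass j.+1 v + a v * c v * pow_mass j v)).
  exact: lerD.
rewrite /pow_mass massS //.
have b0 : 0 <= a v * c v by rewrite mulr_ge0 ?a_ge0 ?c_ge0.
have := exprD_lower j (mass_ge0 0 v) b0.
rewrite -(ler_pM2r (_ : 0 < (j.+1)`!%:R^-1)); last by rewrite invr_gt0 ltr0n fact_gt0.
apply: le_trans; rewrite mulrDl lerD2l factS natrM.
have f0 := fact_neq0 j; have j0 : j.+1%:R != 0 :> rat by rewrite pnatr_eq0.
rewrite le_eqVlt; apply/orP; left; apply/eqP.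
by move: (j.+1%:R : rat) (j`!%:R : rat) j0 f0 => J F J0 F0; field; rewrite J0 F0.
Qed.

(** After r letters, r factors a of the initial weight a^d have been paid and
    r factors c have been paid in advance of the final weight c^d.  The balance
    a^(d-r) / c^r increases, so it may be evaluated at the upper end v. *)
Lemma iter_psum_upper M (h : nat -> nat) (K : rat) d j r v : 0 <= K ->
  (forall u, (u < M)%N -> (h u)%:R <= K * a u ^+ d * pow_mass j u) ->
  (r <= d)%N -> (v < M)%N ->
  (iter r psum h v)%:R <= K * (a v ^+ (d - r) / c v ^+ r) * pow_mass (j + r) v.
Proof.
move=> K0 hM; elim: r v => [|r IHr] v rd vM.
  by rewrite subn0 expr0 divr1 addn0 hM.
rewrite /= psum_natr addnS.
apply: le_trans (_ : \sum_(0 <= u < v)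
  K * (a v ^+ (d - r.+1) / c v ^+ r.+1) * (a u * c u * pow_mass (j + r) u) <= _).
  apply: ler_sum_nat => u /andP[_ uv].
  apply: le_trans (IHr u (ltnW rd) (ltn_trans uv vM)) _.
  have -> : a u ^+ (d - r) / c u ^+ r =
            a u ^+ (d - r.+1) / c u ^+ r.+1 * (a u * c u).
    have cu := lt0r_neq0 (c_gt0 u).
    rewrite (_ : (d - r)%N = (d - r.+1).+1); last by lia.
    by rewrite !exprS; field; rewrite cu expf_neq0.
  rewrite [X in X <= _](_ : _ = K * (a u ^+ (d - r.+1) / c u ^+ r.+1) *
    (a u * c u * pow_mass (j + r) u)); last by rewrite !mulrA.
  apply: ler_wpM2r; first exact: mulr_ge0 (ac_ge0 u) (pow_mass_ge0 _ _).
  rewrite ler_wpM2l // ler_pM ?exprn_ge0 ?invr_ge0 ?exprn_ge0 ?a_ge0 ?c_ge0 //.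
    by rewrite lerXn2r ?nnegrE ?a_ge0 ?c_ge0 // a_homo // ltnW.
  by rewrite lef_pV2 ?posrE ?exprn_gt0 // lerXn2r ?nnegrE ?a_ge0 ?c_ge0 // c_homo // ltnW.
rewrite -mulr_sumr ler_wpM2l ?sum_pow_mass //.
by rewrite mulr_ge0 ?divr_ge0 ?exprn_ge0 ?a_ge0 ?c_ge0.
Qed.

(** After a full period the balance of iter_psum_upper is 1 / c^d, which the
    upper weight at the shared letter settles exactly: there is no loss from
    period to period. *)
Lemma spine_upper_mass M x d y k v (K1 K2 : rat) : 0 <= K1 -> 0 <= K2 ->
  (forall u, (u < M)%N -> 'C(u, x)%:R <= K1 * a u ^+ d) ->
  (forall u, (u < M)%N -> 'C(M.-1 - u, y)%:R <= K2 * c u ^+ d) -> (v < M)%N ->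
  (spine M x d y k v)%:R <= (K1 * K2) ^+ k * pow_mass (k * d) v.
Proof.
move=> K10 K20 hx hy; elim: k v => [|k IHk] v vM.
  by rewrite /pow_mass !expr0 mul1r divr1.
rewrite [spine _ _ _ _ _ _]/= natrM.
have P0 : 0 <= (K1 * K2) ^+ k by rewrite exprn_ge0 ?mulr_ge0.
have H : (iter d psum (fun u => 'C(u, x) * spine M x d y k u)%N v)%:R <=
    K1 * (K1 * K2) ^+ k * (a v ^+ (d - d) / c v ^+ d) * pow_mass (k * d + d) v.
  apply: (iter_psum_upper (M := M)) => //; first by rewrite mulr_ge0.
  move=> u uM; rewrite natrM [X in _ <= X](_ : _ = K1 * a u ^+ d *
    ((K1 * K2) ^+ k * pow_mass (k * d) u)); last by ring.
  by rewrite ler_pM ?hx ?IHk.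
apply: le_trans (ler_pM _ _ (hy v vM) H) _ => //.
rewrite subnn expr0 addnC -mulSn le_eqVlt; apply/orP; left; apply/eqP.
have cv : c v ^+ d != 0 by rewrite expf_neq0 ?lt0r_neq0.
by rewrite [(K1 * K2) ^+ k.+1]exprS; field.
Qed.

Lemma chain_sum_upper_mass M x d y k (K1 K2 : rat) : 0 <= K1 -> 0 <= K2 ->
  (forall u, (u < M)%N -> 'C(u, x)%:R <= K1 * a u ^+ d) ->
  (forall u, (u < M)%N -> 'C(M.-1 - u, y)%:R <= K2 * c u ^+ d) ->
  (chain_sum M x d y k)%:R <= (K1 * K2) ^+ k * (M%:R * pow_mass (k * d) M).
Proof.
move=> K10 K20 hx hy; rewrite /chain_sum natr_sum.
rewrite [M%:R * _]mulrC mulr_natr mulrnAr.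
rewrite -[X in _ <= _ *+ X]subn0 -sumr_const_nat.
apply: ler_sum_nat => v /andP[_ vM].
apply: le_trans (spine_upper_mass k K10 K20 hx hy vM) _.
rewrite ler_wpM2l ?exprn_ge0 ?mulr_ge0 // /pow_mass ler_wpM2r ?invr_ge0 ?ler0n //.
have mm : mass 0 v <= mass 0 M by apply: mass_homo; rewrite leq0n ltnW.
by rewrite lerXn2r ?nnegrE ?mass_ge0 ?mm.
Qed.

Variables (Q : nat) (delta : rat).
Hypothesis mass_le : forall u, a u * c u <= delta.

(** A strictly increasing sequence may not use a letter twice, so the exact
    power is not a lower bound; removing the maximal weight delta once per letter
    compensates for this. *)
Definition low_mass j v : rat :=
  Num.max 0 (mass Q v - j%:R * delta) ^+ j / j`!%:R.

Lemma delta_ge0 : 0 <= delta.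
Proof. by apply: le_trans (mass_le 0); rewrite mulr_ge0 ?a_ge0 ?c_ge0. Qed.

Lemma low_mass_ge0 j v : 0 <= low_mass j v.
Proof. by rewrite divr_ge0 ?exprn_ge0 // le_max lexx. Qed.

Lemma sum_low_mass j v :
  low_mass j.+1 v <= \sum_(Q <= u < v) a u * c u * low_mass j u.
Proof.
have d0 := delta_ge0.
have small w : (w <= Q)%N -> low_mass j.+1 w = 0.
  move=> wQ; rewrite /low_mass /mass big_geq // add0r max_l; last first.
    by rewrite oppr_le0 mulr_ge0.
  by rewrite exprS !mul0r.
elim: v => [|v IHv]; first by rewrite big_geq // small.
case: (leqP Q v) => Qv; last by rewrite big_geq // small.
rewrite big_nat_recr //=; apply: le_trans (lerD IHv (lexx _)).
rewrite /low_mass massS //.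
set g := mass Q v; set b := a v * c v.
have b0 : 0 <= b by rewrite mulr_ge0 ?a_ge0 ?c_ge0.
have bd : b <= delta by exact: mass_le.
set s := Num.max 0 (g - _); set t := Num.max 0 (g + b - _).
set w := Num.max 0 (g - j%:R * delta).
have E : j.+1%:R = j%:R + 1 :> rat by rewrite -natr1.
have s0 : 0 <= s by rewrite le_max lexx.
have st : s <= t.
  by rewrite /s /t ge_max !le_max lexx /=; apply/orP; right; lra.
have tsb : t - s <= b.
  by rewrite /t /s /Num.max; do 2 case: ifP => ?; lra.
have tw : t <= w.
  rewrite /t /w ge_max !le_max lexx /=; apply/orP; right.
  by rewrite E mulrDl mul1r; lra.
have t0 := le_trans s0 st.
have := exprB_upper j s0 st.
have h : j.+1%:R * (t - s) * t ^+ j <= j.+1%:R * b * w ^+ j.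
  rewrite ler_pM ?mulr_ge0 ?exprn_ge0 ?subr_ge0 ?ler_wpM2l //.
  by rewrite lerXn2r // nnegrE (le_trans t0).
move=> /le_trans/(_ (lerD (lexx _) h)).
rewrite -(ler_pM2r (_ : 0 < (j.+1)`!%:R^-1)); last by rewrite invr_gt0 ltr0n fact_gt0.
move=> /le_trans; apply; rewrite mulrDl lerD2l factS natrM.
have f0 := fact_neq0 j; have j0 : j.+1%:R != 0 :> rat by rewrite pnatr_eq0.
rewrite le_eqVlt; apply/orP; left; apply/eqP.
by move: (j.+1%:R : rat) (j`!%:R : rat) j0 f0 => J F J0 F0; field; rewrite J0 F0.
Qed.

(** Here the final weight c^d is available from the beginning and the initial
    weight is claimed late; the balance c^(d-r) / a^r decreases, hence may be
    evaluated at v. *)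
Lemma iter_psum_lower M (h : nat -> nat) (K : rat) d j r v : 0 <= K ->
  (forall u, (Q <= u < M)%N -> K * c u ^+ d * low_mass j u <= (h u)%:R) ->
  (r <= d)%N -> (Q <= v < M)%N ->
  K * (c v ^+ (d - r) / a v ^+ r) * low_mass (j + r) v <= (iter r psum h v)%:R.
Proof.
move=> K0 hM; elim: r v => [|r IHr] v rd vM.
  by rewrite subn0 expr0 divr1 addn0 hM.
rewrite /= psum_natr addnS (@big_cat_nat _ _ _ Q) //=; last by case/andP: vM.
apply: ler_wpDl; first by apply: sumr_ge0.
apply: le_trans (_ : \sum_(Q <= u < v)
  K * (c v ^+ (d - r.+1) / a v ^+ r.+1) * (a u * c u * low_mass (j + r) u) <= _).
  rewrite -mulr_sumr ler_wpM2l ?sum_low_mass //.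
  by rewrite mulr_ge0 ?divr_ge0 ?exprn_ge0 ?a_ge0 ?c_ge0.
apply: ler_sum_nat => u /andP[Qu uv].
have uM : (Q <= u < M)%N by lia.
apply: le_trans _ (IHr u (ltnW rd) uM).
have -> : c u ^+ (d - r) / a u ^+ r =
          c u ^+ (d - r.+1) / a u ^+ r.+1 * (a u * c u).
  have au := lt0r_neq0 (a_gt0 u).
  rewrite (_ : (d - r)%N = (d - r.+1).+1); last by lia.
  by rewrite !exprS; field; rewrite au expf_neq0.
rewrite [X in _ <= X](_ : _ = K * (c u ^+ (d - r.+1) / a u ^+ r.+1) *
  (a u * c u * low_mass (j + r) u)); last by rewrite !mulrA.
apply: ler_wpM2r; first exact: mulr_ge0 (ac_ge0 u) (low_mass_ge0 _ _).
rewrite ler_wpM2l // ler_pM ?exprn_ge0 ?invr_ge0 ?exprn_ge0 ?a_ge0 ?c_ge0 //.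
  by rewrite lerXn2r ?nnegrE ?a_ge0 ?c_ge0 // c_homo // ltnW.
by rewrite lef_pV2 ?posrE ?exprn_gt0 // lerXn2r ?nnegrE ?a_ge0 ?c_ge0 // a_homo // ltnW.
Qed.

(** The balance c^d / a^d reproduces itself over a period, so that it has to be
    compared with 1 only once, at the lowest letter Q of the spine; this is the
    origin of the factor (a Q / c Q)^d. *)
Lemma spine_lower_mass M M' x d y k v (K1 K2 : rat) : 0 <= K1 -> 0 <= K2 ->
  (forall u, (Q <= u < M')%N -> K1 * a u ^+ d <= 'C(u, x)%:R) ->
  (forall u, (Q <= u < M')%N -> K2 * c u ^+ d <= 'C(M.-1 - u, y)%:R) ->
  (Q <= v < M')%N ->
  (a Q / c Q) ^+ d * (K1 * K2) ^+ k * (c v / a v) ^+ d * low_mass (k * d) v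
  <= (spine M x d y k v)%:R.
Proof.
move=> K10 K20 hx hy; set q := (a Q / c Q) ^+ d.
have q0 : 0 <= q by rewrite exprn_ge0 ?divr_ge0 ?a_ge0 ?c_ge0.
have ac0 u : 0 < c u / a u by rewrite divr_gt0.
elim: k v => [|k IHk] v vM.
  rewrite /low_mass !expr0 divr1 !mulr1 -exprMn exprn_ile1 //.
    by rewrite mulr_ge0 ?divr_ge0 ?a_ge0 ?c_ge0.
  rewrite mulf_div ler_pdivrMr ?mulr_gt0 // mul1r mulrC ler_pM ?a_ge0 ?c_ge0 //.
    by rewrite c_homo //; case/andP: vM.
  by rewrite a_homo //; case/andP: vM.
rewrite [spine _ _ _ _ _ _]/= natrM.
have P0 : 0 <= (K1 * K2) ^+ k by rewrite exprn_ge0 ?mulr_ge0.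
have H : q * K1 * (K1 * K2) ^+ k * (c v ^+ (d - d) / a v ^+ d) *
    low_mass (k * d + d) v <=
    (iter d psum (fun u => 'C(u, x) * spine M x d y k u)%N v)%:R.
  apply: (iter_psum_lower (M := M')) => //; first by rewrite !mulr_ge0.
  move=> u uM; rewrite natrM.
  apply: le_trans (ler_pM _ _ (hx u uM) (IHk u uM)).
  - have au : a u ^+ d != 0 by rewrite expf_neq0 ?lt0r_neq0.
    rewrite expr_div_n le_eqVlt; apply/orP; left; apply/eqP; field.
    exact: au.
  - by rewrite mulr_ge0 ?exprn_ge0 ?a_ge0 ?c_ge0.
  exact: mulr_ge0 (mulr_ge0 (mulr_ge0 q0 P0) (exprn_ge0 _ (ltW (ac0 u)))) (low_mass_ge0 _ _).
apply: le_trans _ (ler_pM _ _ (hy v vM) H); first last.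
- apply: mulr_ge0 (low_mass_ge0 _ _); rewrite mulr_ge0 //; first by rewrite !mulr_ge0.
  by rewrite divr_ge0 ?exprn_ge0 ?a_ge0 ?c_ge0.
- by rewrite mulr_ge0 ?exprn_ge0 ?a_ge0 ?c_ge0.
rewrite subnn expr0 addnC -mulSn le_eqVlt; apply/orP; left; apply/eqP.
have av : a v ^+ d != 0 by rewrite expf_neq0 ?lt0r_neq0.
by rewrite expr_div_n [(K1 * K2) ^+ k.+1]exprS; field.
Qed.

Lemma chain_sum_lower_mass M M' x d y k (K1 K2 : rat) : 0 <= K1 -> 0 <= K2 ->
  (forall u, (Q <= u < M')%N -> K1 * a u ^+ d <= 'C(u, x)%:R) ->
  (forall u, (Q <= u < M')%N -> K2 * c u ^+ d <= 'C(M.-1 - u, y)%:R) ->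
  (Q + Q <= M' <= M)%N ->
  Q%:R * ((a Q / c Q) ^+ d * (K1 * K2) ^+ k * (c M'.-1 / a M'.-1) ^+ d *
          low_mass (k * d) (M' - Q)) <= (chain_sum M x d y k)%:R.
Proof.
move=> K10 K20 hx hy hM; rewrite /chain_sum natr_sum.
rewrite (@big_cat_nat _ _ _ (M' - Q)) //=; last by lia.
apply: ler_wpDl; first by apply: sumr_ge0.
rewrite (@big_cat_nat _ _ _ M') //=; [|lia|lia].
apply: ler_wpDr; first by apply: sumr_ge0.
rewrite mulrC mulr_natr -[X in _ *+ X](_ : (M' - (M' - Q))%N = Q); last by lia.
rewrite -sumr_const_nat.
apply: ler_sum_nat => v /andP[vl vr].
have vM : (Q <= v < M')%N by lia.
apply: le_trans _ (spine_lower_mass k K10 K20 hx hy vM).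
have P0 : 0 <= (K1 * K2) ^+ k by rewrite exprn_ge0 ?mulr_ge0.
have q0 : 0 <= (a Q / c Q) ^+ d by rewrite exprn_ge0 ?divr_ge0 ?a_ge0 ?c_ge0.
have ca0 u : 0 <= c u / a u by rewrite divr_ge0 ?a_ge0 ?c_ge0.
apply: ler_pM; last 1 first.
- have pos (z : rat) : 0 <= Num.max 0 z by rewrite le_max lexx.
  rewrite /low_mass ler_wpM2r ?invr_ge0 ?ler0n // lerXn2r ?nnegrE ?pos //.
  rewrite ge_max !le_max lexx /=; apply/orP; right; rewrite lerD2r.
  by rewrite mass_homo //; lia.
- exact: mulr_ge0 (mulr_ge0 q0 P0) (exprn_ge0 _ (ca0 _)).
- exact: low_mass_ge0.
apply: ler_wpM2l; first exact: mulr_ge0.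
apply: lerXn2r; rewrite ?nnegrE ?ca0 //.
apply: ler_pM; rewrite ?invr_ge0 ?a_ge0 ?c_ge0 //; first by rewrite c_homo; lia.
by rewrite lef_pV2 ?posrE // a_homo; lia.
Qed.

End Weights.

(** * Discrete powers with fractional exponent *)

Lemma ler_prod_nat m n (F G : nat -> rat) :
  (forall i, (m <= i < n)%N -> 0 <= F i <= G i) ->
  \prod_(m <= i < n) F i <= \prod_(m <= i < n) G i.
Proof. by move=> le_FG; rewrite !big_nat ler_prod. Qed.

(** The binomial coefficient binom(n + g, n) for a rational number g, of order
    n^g. *)
Definition rising (g : rat) (n : nat) : rat := \prod_(0 <= s < n) (1 + g / s.+1%:R).

Lemma rising0 g : rising g 0 = 1.
Proof. by rewrite /rising big_geq. Qed.

Lemma risingS g n : rising g n.+1 = rising g n * (1 + g / n.+1%:R).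
Proof. by rewrite /rising big_nat_recr. Qed.

Lemma natS_neq0 n : n.+1%:R != 0 :> rat.
Proof. by rewrite pnatr_eq0. Qed.

Lemma risingSl g n : n.+1%:R * rising g n.+1 = (n.+1%:R + g) * rising g n.
Proof.
rewrite risingS; have := natS_neq0 n.
by move: (n.+1%:R : rat) (rising g n) => N R N0; field.
Qed.

Lemma rising_ge1 g n : 0 <= g -> 1 <= rising g n.
Proof.
move=> g0; elim: n => [|n IHn]; first by rewrite rising0.
rewrite risingS -[X in X <= _]mulr1 ler_pM // lerDl divr_ge0 //.
Qed.

Lemma rising_gt0 g n : 0 <= g -> 0 < rising g n.
Proof. by move=> g0; apply: lt_le_trans (rising_ge1 n g0). Qed.

Lemma rising_homo g m n : 0 <= g -> (m <= n)%N -> rising g m <= rising g n.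
Proof.
move=> g0 /subnKC <-; elim: (n - m)%N => [|k IHk]; first by rewrite addn0.
rewrite addnS risingS; apply: (le_trans IHk).
by rewrite ler_peMr ?(ltW (rising_gt0 _ g0)) // lerDl divr_ge0.
Qed.

Lemma rising_nat x n : rising x%:R n = 'C(n + x, x)%:R.
Proof.
elim: n => [|n IHn]; first by rewrite rising0 add0n binn.
apply: (mulfI (natS_neq0 n)); rewrite risingSl IHn -natrD -!natrM; congr _%:R.
have := mul_bin_down (n.+1 + x) x; rewrite addnK => <-.
by rewrite addSn.
Qed.

(** The Chu-Vandermonde identity.  Multiplied by n = i + (n - i), each side
    satisfies the same first-order recursion. *)
Lemma rising_conv a b n :
  \sum_(0 <= i < n.+1) rising a i * rising b (n - i) = rising (a + b + 1) n.
Proof.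
elim: n => [|n IHn]; first by rewrite big_nat1 !rising0 mulr1.
apply: (mulfI (natS_neq0 n)); rewrite risingSl -IHn [LHS]mulr_sumr.
transitivity (\sum_(0 <= i < n.+2) (i%:R * rising a i * rising b (n.+1 - i)) +
  \sum_(0 <= i < n.+2) ((n.+1 - i)%:R * rising b (n.+1 - i) * rising a i)).
  rewrite -big_split /=; apply: eq_big_nat => i /andP[_ iN].
  by rewrite natrB //; ring.
rewrite [X in X + _]big_nat_recl // mul0r mul0r add0r.
rewrite [X in _ + X]big_nat_recr //= subnn !mul0r addr0 -big_split /= mulr_sumr.
apply: eq_big_nat => i /andP[_ iN]; rewrite risingSl subSS.
rewrite subSn // risingSl -natr1 -[(n - i).+1%:R]natr1 -[n.+1%:R]natr1 natrB //.
ring.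
Qed.

Section Factor.

Variable d : nat.
Hypothesis d_gt0 : (0 < d)%N.

(** The rational substitute for u^(x/d). *)
Definition root_weight (x u : nat) : rat := rising (x%:R / d%:R) u.

(** The factors of root_defect, which compares the x-th power with the d-th
    power of its substitute root: binom(dn + x, x) = root_defect x n *
    (root_weight x n)^d.  Its limit is Gamma(1 + x/d)^d / Gamma(1 + x), up to
    a power of d. *)
Definition defect_factor (x u r : nat) : rat :=
  (1 + x%:R / (d * u + r).+1%:R) / (1 + x%:R / (d * u.+1)%:R).

Definition defect_row (x u : nat) : rat := \prod_(0 <= r < d) defect_factor x u r.

Definition root_defect (x n : nat) : rat := \prod_(0 <= u < n) defect_row x u.

Lemma one_plus_ratio_gt0 (x n : nat) : 0 < 1 + x%:R / n%:R :> rat.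
Proof. by rewrite ltr_pwDl // divr_ge0. Qed.

Lemma root_defectS x n : root_defect x n.+1 = root_defect x n * defect_row x n.
Proof. by rewrite /root_defect big_nat_recr. Qed.

Lemma rising_add g n j : rising g (n + j) =
  rising g n * \prod_(0 <= r < j) (1 + g / (n + r).+1%:R).
Proof.
elim: j => [|j IHj]; first by rewrite addn0 big_geq // mulr1.
by rewrite addnS risingS IHj big_nat_recr //= mulrA.
Qed.

Lemma d_neq0 : d%:R != 0 :> rat. Proof. by rewrite pnatr_eq0 -lt0n. Qed.

(** The denominator of defect_factor is the same for all r, and its d-th power
    is the step of the d-th power of root_weight. *)
Lemma defect_rowE x u : defect_row x u * (1 + x%:R / (d * u.+1)%:R) ^+ d =
  \prod_(0 <= r < d) (1 + x%:R / (d * u + r).+1%:R).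
Proof.
rewrite -[X in _ ^+ X](subn0 d) -prodr_const_nat -big_split /=.
apply: eq_bigr => r _ /=; rewrite /defect_factor divfK // lt0r_neq0 //; exact: one_plus_ratio_gt0.
Qed.

Lemma root_defectE x n : rising x%:R (d * n) = root_defect x n * root_weight x n ^+ d.
Proof.
elim: n => [|n IHn].
  by rewrite muln0 /root_defect /root_weight !rising0 big_geq // expr1n mulr1.
rewrite root_defectS /root_weight risingS exprMn -/(root_weight x n).
rewrite mulrACA -IHn mulnSr rising_add; congr (_ * _); rewrite -defect_rowE.
congr (_ * (1 + _) ^+ d); rewrite natrM.
have := natS_neq0 n; have := d_neq0.
by move: (d%:R : rat) (n.+1%:R : rat) => D N D0 N0; field; rewrite D0 N0.
Qed.

Lemma natdiv_le (x a b : nat) : (0 < a)%N -> (a <= b)%N ->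
  x%:R / b%:R <= x%:R / a%:R :> rat.
Proof.
move=> a0 ab; rewrite ler_wpM2l // lef_pV2 ?posrE ?ltr0n ?ler_nat //.
exact: leq_trans ab.
Qed.

Lemma defect_factor_ge1 x u r : (r < d)%N -> 1 <= defect_factor x u r.
Proof.
move=> rd; rewrite /defect_factor ler_pdivlMr ?one_plus_ratio_gt0 // mul1r lerD2l natdiv_le //.
by rewrite mulnS; lia.
Qed.

Lemma defect_row_ge1 x u : 1 <= defect_row x u.
Proof.
rewrite /defect_row big_nat_cond; apply: (big_ind (fun z : rat => 1 <= z)) => //.
  by move=> a b a1 b1; rewrite -[X in X <= _]mulr1 ler_pM.
by move=> r /andP[/andP[_ rd] _]; exact: defect_factor_ge1.
Qed.

Lemma root_defect_gt0 x n : 0 < root_defect x n.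
Proof.
rewrite /root_defect; apply: prodr_gt0 => u _; exact: lt_le_trans (defect_row_ge1 x u).
Qed.

Lemma root_defect_homo x m n : (m <= n)%N -> root_defect x m <= root_defect x n.
Proof.
move=> /subnKC <-; elim: (n - m)%N => [|k IHk]; first by rewrite addn0.
rewrite addnS root_defectS; apply: (le_trans IHk).
by rewrite ler_peMr ?(ltW (root_defect_gt0 _ _)) // defect_row_ge1.
Qed.

(** The product of the rows from m on telescopes when each numerator of a row is
    bounded by the denominator of the previous row.  Hence the partial products converge,
    with an explicit rate. *)
Lemma root_defect_tail x m n : (0 < m <= n)%N ->
  root_defect x n <= root_defect x m * (1 + x%:R / (d * m)%:R) ^+ d.
Proof.
case/andP => m0 /subnKC <-.
apply: le_trans (_ : root_defect x (m + (n - m)) *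
   (1 + x%:R / (d * (m + (n - m)))%:R) ^+ d <= _).
  rewrite ler_peMr ?(ltW (root_defect_gt0 _ _)) // exprn_ege1 // lerDl divr_ge0 //.
elim: (n - m)%N => [|k IHk]; first by rewrite addn0.
apply: le_trans IHk; rewrite addnS root_defectS -mulrA.
rewrite ler_wpM2l ?(ltW (root_defect_gt0 _ _)) // defect_rowE.
rewrite -[X in _ ^+ X]subn0 -prodr_const_nat; apply: ler_prod_nat => r /andP[_ rd].
rewrite (ltW (one_plus_ratio_gt0 _ _)) /= lerD2l natdiv_le ?muln_gt0 ?d_gt0 /=; first by [].
  by rewrite addn_gt0 m0.
by rewrite leqW // leq_addr.
Qed.

(** Since (1 + x/z)(1 + y/z) = 1 + (x + y)/z + xy/z^2, for x + y fixed only xy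
    matters, and its effect is stronger for the smaller of the two values of z,
    which is in the numerator. *)
Lemma defect_factor_spread x y x' y' u r : (x + y = x' + y')%N -> (x * y <= x' * y')%N ->
  (r < d)%N -> defect_factor x u r * defect_factor y u r <= defect_factor x' u r * defect_factor y' u r.
Proof.
move=> sumE prodE rd; rewrite /defect_factor !mulf_div.
have sE : x%:R + y%:R = x'%:R + y'%:R :> rat by rewrite -!natrD sumE.
have pE : x%:R * y%:R <= x'%:R * y'%:R :> rat by rewrite -!natrM ler_nat.
have pq : (d * u + r).+1%:R <= (d * u.+1)%:R :> rat by rewrite ler_nat mulnS; lia.
have p0 : 0 < (d * u + r).+1%:R :> rat by rewrite ltr0n.
have X0 : 0 <= x%:R :> rat by []. have Y0 : 0 <= y%:R :> rat by [].
rewrite ler_pdivrMr ?mulr_gt0 ?one_plus_ratio_gt0 // mulrAC ler_pdivlMr ?mulr_gt0 ?one_plus_ratio_gt0 //.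
move: p0 pq sE pE X0 Y0.
move: (x%:R : rat) (y%:R : rat) (x'%:R : rat) (y'%:R : rat)
  ((d * u + r).+1%:R : rat) ((d * u.+1)%:R : rat) => X Y X' Y' p q p0 pq sE pE X0 Y0.
have q0 : 0 < q := lt_le_trans p0 pq.
have lin z : (1 + X / z) * (1 + Y / z) = 1 + (X + Y) * z^-1 + X * Y * z^-1 ^+ 2.
  by ring.
have lin' z : (1 + X' / z) * (1 + Y' / z) = 1 + (X + Y) * z^-1 + X' * Y' * z^-1 ^+ 2.
  by rewrite sE; ring.
rewrite !lin !lin'.
have pqV : q^-1 <= p^-1 by rewrite lef_pV2 ?posrE.
have qV0 : 0 < q^-1 by rewrite invr_gt0.
move: (X * Y) (X' * Y') pE (X + Y) (addr_ge0 X0 Y0) => P P' PP S S0.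
move: (p^-1) (q^-1) pqV qV0 => a b ab b0.
have h1 : 0 <= (P' - P) * (a - b) * (a + b) by rewrite !mulr_ge0 ?subr_ge0 ?addr_ge0 //; lra.
have h2 : 0 <= (P' - P) * S * a * b * (a - b).
  by rewrite !mulr_ge0 ?subr_ge0 //; lra.
lra.
Qed.

Lemma defect_factor_spread_lt x y x' y' : (x + y = x' + y')%N -> (x * y < x' * y')%N ->
  (1 < d)%N -> defect_factor x 0 0 * defect_factor y 0 0 < defect_factor x' 0 0 * defect_factor y' 0 0.
Proof.
move=> sumE prodE d1; rewrite /defect_factor !mulf_div muln0 muln1 !addn0.
have sE : x%:R + y%:R = x'%:R + y'%:R :> rat by rewrite -!natrD sumE.
have pE : x%:R * y%:R < x'%:R * y'%:R :> rat by rewrite -!natrM ltr_nat.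
have X0 : 0 <= x%:R :> rat by []. have Y0 : 0 <= y%:R :> rat by [].
rewrite ltr_pdivrMr ?mulr_gt0 ?one_plus_ratio_gt0 // mulrAC ltr_pdivlMr ?mulr_gt0 ?one_plus_ratio_gt0 //.
have d1' : 1 < d%:R :> rat by rewrite ltr1n.
move: d1' sE pE X0 Y0.
move: (x%:R : rat) (y%:R : rat) (x'%:R : rat) (y'%:R : rat)
  (d%:R : rat) => X Y X' Y' q q1 sE pE X0 Y0.
have q0 : 0 < q by lra.
have lin z : (1 + X / z) * (1 + Y / z) = 1 + (X + Y) * z^-1 + X * Y * z^-1 ^+ 2.
  by ring.
have lin' z : (1 + X' / z) * (1 + Y' / z) = 1 + (X + Y) * z^-1 + X' * Y' * z^-1 ^+ 2.
  by rewrite sE; ring.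
rewrite !lin !lin' invr1.
have pqV : q^-1 < 1 by rewrite invf_lt1.
have qV0 : 0 < q^-1 by rewrite invr_gt0.
move: (X * Y) (X' * Y') pE (X + Y) (addr_ge0 X0 Y0) => P P' PP S S0.
move: (q^-1) pqV qV0 => b ab b0.
have h1 : 0 < (P' - P) * (1 - b) * (1 + b) by rewrite !mulr_gt0 ?subr_gt0 ?addr_gt0 //; lra.
have h2 : 0 <= (P' - P) * S * b * (1 - b).
  by rewrite !mulr_ge0 //; lra.
lra.
Qed.

(** The factor u = r = 0 gains a fixed quotient g > 1, and no factor loses.
    For d = 1 that factor is trivial, whence the hypothesis on d. *)
Lemma root_defect_spread x y x' y' : (x + y = x' + y')%N -> (x * y < x' * y')%N ->
  (1 < d)%N -> exists2 g : rat, 1 < g & forall M, (0 < M)%N ->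
  g * (root_defect x M * root_defect y M) <= root_defect x' M * root_defect y' M.
Proof.
move=> sumE prodE d1.
have t0 z u r : (r < d)%N -> 0 < defect_factor z u r.
  by move=> rd; apply: lt_le_trans (defect_factor_ge1 z u rd).
have p0 : 0 < defect_factor x 0 0 * defect_factor y 0 0 by rewrite mulr_gt0 ?t0.
exists (defect_factor x' 0 0 * defect_factor y' 0 0 / (defect_factor x 0 0 * defect_factor y 0 0)).
  by rewrite ltr_pdivlMr // mul1r defect_factor_spread_lt.
set g := _ / _.
have gE : g * (defect_factor x 0 0 * defect_factor y 0 0) = defect_factor x' 0 0 * defect_factor y' 0 0.
  by rewrite /g divfK // lt0r_neq0.
have row_pos z u : 0 <= defect_row z u by apply: le_trans (defect_row_ge1 z u).
have rowle u : defect_row x u * defect_row y u <= defect_row x' u * defect_row y' u.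
  rewrite /defect_row -!big_split /=; apply: ler_prod_nat => r /andP[_ rd].
  by rewrite mulr_ge0 ?(ltW (t0 _ _ _ _)) //= defect_factor_spread // ltnW.
have row0 : g * (defect_row x 0 * defect_row y 0) <= defect_row x' 0 * defect_row y' 0.
  rewrite /defect_row -!big_split /= !(@big_ltn _ _ _ 0) // mulrA gE.
  have p0' : 0 <= defect_factor x' 0 0 * defect_factor y' 0 0 by rewrite ltW // mulr_gt0 ?t0.
  rewrite ler_wpM2l //; apply: ler_prod_nat => r /andP[_ rd].
  by rewrite mulr_ge0 ?(ltW (t0 _ _ _ _)) //= defect_factor_spread // ltnW.
case=> // M _; elim: M => [|M IHM]; first by rewrite /root_defect !big_nat1.
rewrite !(root_defectS _ M.+1) !(mulrACA _ (defect_row _ _)) [g * _]mulrA.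
have g0 : 0 <= g by rewrite divr_ge0 ?(ltW p0) // ltW // mulr_gt0 ?t0.
apply: ler_pM (IHM) (rowle _); last exact: mulr_ge0.
by rewrite mulr_ge0 // mulr_ge0 // ltW // root_defect_gt0.
Qed.

Lemma ffact_gap n x : (n ^ x <= (n + x) ^_ x)%N.
Proof.
elim: x => [|x IHx] //; rewrite addnS ffactSS expnS leq_mul //; lia.
Qed.

Lemma bin_le_root_defect x u M : (u <= M)%N ->
  'C(u, x)%:R <= root_defect x M / d%:R ^+ x * root_weight x u ^+ d.
Proof.
move=> uM; have dx : 0 < d%:R ^+ x :> rat by rewrite exprn_gt0 // ltr0n.
rewrite mulrAC ler_pdivlMr //.
apply: le_trans (_ : 'C(d * u + x, x)%:R <= _); last first.
  rewrite -rising_nat root_defectE ler_wpM2r ?root_defect_homo //.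
  by rewrite exprn_ge0 // ltW // rising_gt0 // divr_ge0.
rewrite -natrX -natrM ler_nat -(leq_pmul2r (fact_gt0 x)) mulnAC [X in (_ <= X)%N]bin_ffact.
apply: leq_trans (leq_mul (bin_leq_exp u x) (leqnn _)) _.
by rewrite -expnMn mulnC ffact_gap.
Qed.

Lemma root_defect_le_bin x u Q s : (x <= s)%N -> (s < Q <= u)%N ->
  ((Q - s)%:R / (Q + s)%:R) ^+ x * root_defect x Q / d%:R ^+ x * root_weight x u ^+ d <=
  'C(u, x)%:R.
Proof.
move=> xs /andP[sQ Qu]; have dx : 0 < d%:R ^+ x :> rat by rewrite exprn_gt0 // ltr0n.
have qs : 0 < (Q + s)%:R :> rat by rewrite ltr0n; lia.
rewrite mulrAC ler_pdivrMr // expr_div_n -!mulrA mulrCA ler_pdivrMl ?exprn_gt0 //.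
apply: le_trans (_ : (Q - s)%:R ^+ x * 'C(d * u + x, x)%:R <= _).
  rewrite ler_wpM2l ?exprn_ge0 // -rising_nat root_defectE ler_wpM2r ?root_defect_homo //.
  by rewrite exprn_ge0 // ltW // rising_gt0 // divr_ge0.
rewrite -!natrX -!natrM ler_nat -(leq_pmul2r (fact_gt0 x)) -!mulnA bin_ffact.
apply: (@leq_trans ((Q - s) ^ x * (d * (u + x)) ^ x)).
  rewrite leq_mul //; apply: leq_trans (_ : (d * u + x) ^ x <= _)%N.
    elim: x {xs dx} (d * u + x)%N => // x IHx n.
    by rewrite ffactnSr expnSr leq_mul ?IHx // leq_subr.
  case: x {xs dx} => // x; rewrite leq_exp2r // mulnDr leq_add2l.
  exact: leq_pmull.
have low : ((u - x) ^ x <= u ^_ x)%N.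
  have H j : (j <= x -> (u - x) ^ j <= u ^_ j)%N.
    elim: j => // j IHj jx; rewrite expnSr ffactnSr leq_mul ?IHj ?(ltnW jx) //; lia.
  exact: H.
apply: (@leq_trans ((Q + s) ^ x * ((u - x) ^ x * d ^ x))); last first.
  rewrite leq_mul //; apply: leq_trans (leq_mul low (leqnn _)) _.
  by rewrite -bin_ffact; apply: eq_leq; ring.
rewrite -!expnMn; case: x {dx low} xs => // x xs; rewrite leq_exp2r //.
have h : ((Q - s) * (u + x.+1) <= (Q + s) * (u - x.+1))%N by nia.
by have := leq_mul (leqnn d) h; lia.
Qed.

Lemma root_weight_gt0 x u : 0 < root_weight x u.
Proof. by rewrite rising_gt0 // divr_ge0. Qed.

Lemma root_weight_homo x u v : (u <= v)%N -> root_weight x u <= root_weight x v.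
Proof. by apply: rising_homo; rewrite divr_ge0. Qed.

(** Polynomial growth, in a form without constants: x/d <= x, and the bound
    holds for binom(n + x, x). *)
Lemma root_weight_scale x l R : (0 < l)%N ->
  root_weight x (l * R) <= l%:R ^+ x * root_weight x R.
Proof.
move=> l0; have lR : (R <= l * R)%N by rewrite leq_pmull.
have mono j : root_weight x (R + j) * rising x%:R R <= root_weight x R * rising x%:R (R + j).
  elim: j => [|j IHj]; first by rewrite addn0.
  rewrite addnS {1}/root_weight !risingS -/(root_weight _ _) mulrAC [X in _ <= X]mulrA.
  rewrite ler_pM ?mulr_ge0 ?(ltW (root_weight_gt0 _ _)) ?(ltW (rising_gt0 _ _)) //.
    by rewrite addr_ge0 // !divr_ge0.
  rewrite lerD2l ler_wpM2r ?invr_ge0 // ler_pdivrMr ?ltr0n //.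
  by rewrite -natrM ler_nat leq_pmulr.
have := mono (l * R - R)%N; rewrite subnKC // -ler_pdivlMr; last first.
  by rewrite rising_gt0.
move=> /le_trans; apply; rewrite ler_pdivrMr ?rising_gt0 //.
rewrite [X in _ <= X](_ : _ = root_weight x R * (l%:R ^+ x * rising x%:R R)); last by ring.
rewrite ler_wpM2l ?(ltW (root_weight_gt0 _ _)) // !rising_nat -natrX -natrM ler_nat.
rewrite -(leq_pmul2r (fact_gt0 x)) -mulnA !bin_ffact.
elim: x {mono} => // x IHx; rewrite !addnS !ffactSS expnS mulnACA leq_mul //.
by rewrite -!addnS mulnDr leq_add2l leq_pmull.
Qed.

End Factor.

(** * Chain counts between two exponential bounds *)

Section Comparison.

Variables (d M : nat).
Hypotheses (d_gt0 : (0 < d)%N) (M_gt0 : (0 < M)%N).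

(** Capped at M - 1, the largest letter, so that the product of the two weights
    is bounded on all natural numbers. *)
Definition up_weight (x u : nat) : rat := root_weight d x (minn u M.-1).
Definition down_weight (y v : nat) : rat := root_weight d y (M.-1 - v).

(** The sum of the product of the weights over all letters; it depends on x and
    y only through s = x + y, which is why it cancels in the comparison. *)
Definition total_mass (s : nat) : rat := rising (s%:R / d%:R + 1) M.-1.

Lemma up_weight_gt0 x u : 0 < up_weight x u. Proof. exact: root_weight_gt0. Qed.
Lemma down_weight_gt0 x u : 0 < down_weight x u. Proof. exact: root_weight_gt0. Qed.

Lemma up_weight_homo x u v : (u <= v)%N -> up_weight x u <= up_weight x v.
Proof. by move=> uv; apply: root_weight_homo; lia. Qed.

Lemma down_weight_homo x u v : (u <= v)%N -> down_weight x v <= down_weight x u.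
Proof. by move=> uv; apply: root_weight_homo; lia. Qed.

Lemma up_weightE x u : (u < M)%N -> up_weight x u = root_weight d x u.
Proof. by move=> uM; rewrite /up_weight (minn_idPl _) //; lia. Qed.

Lemma total_massE x y : mass (up_weight x) (down_weight y) 0 M = total_mass (x + y).
Proof.
rewrite /total_mass natrD mulrDl -rising_conv prednK //.
by apply: eq_big_nat => u /andP[_ uM]; rewrite up_weightE.
Qed.

Lemma total_mass_gt0 s : 0 < total_mass s.
Proof. by rewrite rising_gt0 // addr_ge0 // divr_ge0. Qed.

Lemma chain_sum_sharp_upper x y k :
  (chain_sum M x d y k)%:R <=
  (root_defect d x M * root_defect d y M / d%:R ^+ (x + y)) ^+ k *
  (M%:R * (total_mass (x + y) ^+ (k * d) / (k * d)`!%:R)).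
Proof.
have d0 := d_neq0 d_gt0.
have K0 z : 0 <= root_defect d z M / d%:R ^+ z.
  by rewrite divr_ge0 ?exprn_ge0 // ltW // root_defect_gt0.
have := @chain_sum_upper_mass (up_weight x) (down_weight y) (up_weight_gt0 x)
  (down_weight_gt0 y) (@up_weight_homo x) (@down_weight_homo y) M x d y k _ _ (K0 x) (K0 y).
rewrite /pow_mass total_massE exprD mulf_div; apply => u uM.
  by rewrite up_weightE // bin_le_root_defect // ltnW.
by rewrite bin_le_root_defect //; lia.
Qed.

(** No letter carries more than a constant times the average weight: on the
    middle third both weights are within a constant factor of their maxima. *)
Lemma weight_le_mass x y R u : M = (3 * R)%N -> (0 < R)%N ->
  up_weight x u * down_weight y u <= 3 ^+ (x + y) * total_mass (x + y) / R%:R.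
Proof.
move=> ME R0.
have scale z v : (v <= M)%N -> root_weight d z v <= 3 ^+ z * root_weight d z R.
  move=> vM; apply: le_trans (root_weight_homo d z vM) _.
  by rewrite ME root_weight_scale.
have pos z v : 0 <= root_weight d z v by rewrite ltW // root_weight_gt0.
apply: le_trans (_ : 3 ^+ (x + y) * (root_weight d x R * root_weight d y R) <= _).
  rewrite exprD mulrACA ler_pM ?pos //; apply: scale; lia.
rewrite ler_pdivlMr ?ltr0n // -mulrA ler_wpM2l ?exprn_ge0 // -total_massE.
have hs : mass (up_weight x) (down_weight y) R (R + R) <=
            mass (up_weight x) (down_weight y) 0 M.
  rewrite {2}/mass (@big_cat_nat _ _ _ R) //=; last by lia.
  apply: ler_wpDl; first by apply: sumr_ge0 => i _; rewrite mulr_ge0 ?pos.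
  rewrite (@big_cat_nat _ _ _ (R + R)) //=; [|lia|lia].
  by apply: ler_wpDr => //; apply: sumr_ge0 => i _; rewrite mulr_ge0 ?pos.
apply: le_trans hs; rewrite /mass mulr_natr -[X in _ *+ X](addKn R) -sumr_const_nat.
apply: ler_sum_nat => i /andP[Ri iR]; rewrite up_weightE; last by lia.
by rewrite ler_pM ?pos // root_weight_homo //; lia.
Qed.

(** The spine is confined to [Q, M - Q) with M = 3LQ.  There the binomials are
    nearly powers, and by weight_le_mass the excluded ends and the correction
    k d delta together cost at most the proportion 4 * 3^s / L of the mass.  The
    remaining loss (3L)^(-sd) comes from the ends of the spine and does not
    depend on k. *)
Lemma chain_sum_sharp_lower x y k L Q : M = (3 * L * Q)%N ->
  (1 < L)%N -> (x + y < Q)%N -> (k * d <= Q)%N -> 4 * 3 ^+ (x + y) <= L%:R :> rat ->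
  Q%:R * ((3 * L)%:R ^- ((x + y) * d) *
    (((Q - (x + y))%:R / (Q + (x + y))%:R) ^+ (x + y) *
       (root_defect d x Q * root_defect d y Q / d%:R ^+ (x + y))) ^+ k *
    ((total_mass (x + y) * (1 - 4 * 3 ^+ (x + y) / L%:R)) ^+ (k * d) / (k * d)`!%:R))
  <= (chain_sum M x d y k)%:R.
Proof.
set s := (x + y)%N => ME L1 sQ kQ Ls; have d0 := d_neq0 d_gt0.
have Q0 : (0 < Q)%N by lia.
have R0 : (0 < L * Q)%N by rewrite muln_gt0 Q0; lia.
have MR : M = (3 * (L * Q))%N by rewrite ME mulnA.
have LQ2 : (2 * Q <= L * Q)%N by rewrite leq_mul2r L1 orbT.
have eM : (M - Q - Q + 2 * Q = M)%N by lia.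
have eQ : (Q <= M - Q - Q)%N by lia.
have eQM : (M - Q - Q <= M)%N by lia.
pose delta : rat := 3 ^+ s * total_mass s / (L * Q)%:R.
have mle u : up_weight x u * down_weight y u <= delta by apply: weight_le_mass.
pose w : rat := (Q - s)%:R / (Q + s)%:R.
have w0 : 0 <= w by rewrite divr_ge0.
have K0 z : 0 <= w ^+ z * root_defect d z Q / d%:R ^+ z.
  by rewrite divr_ge0 ?exprn_ge0 // mulr_ge0 ?exprn_ge0 // ltW // root_defect_gt0.
have := @chain_sum_lower_mass (up_weight x) (down_weight y) (up_weight_gt0 x)
  (down_weight_gt0 y) (@up_weight_homo x) (@down_weight_homo y) Q delta mle M (M - Q) x d y k _ _ (K0 x) (K0 y).
have hx u : (Q <= u < M - Q)%N ->
    w ^+ x * root_defect d x Q / d%:R ^+ x * up_weight x u ^+ d <= 'C(u, x)%:R.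
  move=> hu; rewrite up_weightE; last by lia.
  by apply: root_defect_le_bin; rewrite // /s; lia.
have hy u : (Q <= u < M - Q)%N ->
    w ^+ y * root_defect d y Q / d%:R ^+ y * down_weight y u ^+ d <= 'C(M.-1 - u, y)%:R.
  by move=> hu; apply: root_defect_le_bin; rewrite // /s; lia.
move=> /(_ hx hy (_ : _)) H; apply: le_trans (H _); last by lia.
rewrite ler_wpM2l //.
have rpos z v : 0 < root_weight d z v by apply: root_weight_gt0.
have KE : w ^+ x * root_defect d x Q / d%:R ^+ x *
            (w ^+ y * root_defect d y Q / d%:R ^+ y) =
          w ^+ s * (root_defect d x Q * root_defect d y Q / d%:R ^+ s).
  rewrite /s !exprD; field; by rewrite !expf_neq0.
have KK0 : 0 <= w ^+ s * (root_defect d x Q * root_defect d y Q / d%:R ^+ s).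
  by rewrite -KE mulr_ge0.
rewrite KE [X in _ <= X](_ : _ =
   (up_weight x Q / down_weight y Q) ^+ d *
   (down_weight y (M - Q).-1 / up_weight x (M - Q).-1) ^+ d *
   (w ^+ s * (root_defect d x Q * root_defect d y Q / d%:R ^+ s)) ^+ k *
   low_mass (up_weight x) (down_weight y) Q delta (k * d) (M - Q - Q)); last by ring.
have ends : (3 * L)%:R ^- (s * d) <= (up_weight x Q / down_weight y Q) ^+ d *
    (down_weight y (M - Q).-1 / up_weight x (M - Q).-1) ^+ d.
  rewrite exprM -exprVn -exprMn lerXn2r ?nnegrE ?invr_ge0 ?exprn_ge0 //.
    by rewrite mulr_ge0 // divr_ge0 // ltW // ?up_weight_gt0 ?down_weight_gt0.
  rewrite mulf_div ler_pdivlMr ?mulr_gt0 ?up_weight_gt0 ?down_weight_gt0 //.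
  rewrite ler_pdivrMl ?exprn_gt0 ?ltr0n ?muln_gt0 //; last by lia.
  have E1 : up_weight x Q = root_weight d x Q by rewrite up_weightE //; lia.
  have E2 : down_weight y (M - Q).-1 = root_weight d y Q.
    by rewrite /down_weight; congr root_weight; lia.
  have b1 : up_weight x (M - Q).-1 <= (3 * L)%:R ^+ x * root_weight d x Q.
    apply: le_trans (root_weight_scale d_gt0 x Q (_ : 0 < 3 * L)%N); last by lia.
    by apply: root_weight_homo; rewrite -ME; lia.
  have b2 : down_weight y Q <= (3 * L)%:R ^+ y * root_weight d y Q.
    apply: le_trans (root_weight_scale d_gt0 y Q (_ : 0 < 3 * L)%N); last by lia.
    by apply: root_weight_homo; rewrite -ME; lia.
  rewrite E1 E2.
  have := ler_pM (ltW (down_weight_gt0 y Q)) (ltW (up_weight_gt0 x (M - Q).-1)) b2 b1.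
  move=> /le_trans; apply; rewrite le_eqVlt; apply/orP; left; apply/eqP.
  by rewrite /s exprD; ring.
have LR0 : 0 < L%:R :> rat by rewrite ltr0n; lia.
have eta1 : 0 <= 1 - 4 * 3 ^+ s / L%:R :> rat by rewrite subr_ge0 ler_pdivrMr // mul1r.
have T0 : 0 <= total_mass s * (1 - 4 * 3 ^+ s / L%:R).
  by rewrite mulr_ge0 // ltW // total_mass_gt0.
have mid : (total_mass s * (1 - 4 * 3 ^+ s / L%:R)) ^+ (k * d) / (k * d)`!%:R <=
    low_mass (up_weight x) (down_weight y) Q delta (k * d) (M - Q - Q).
  rewrite /low_mass ler_wpM2r ?invr_ge0 ?ler0n // lerXn2r ?nnegrE //.
    by rewrite le_max lexx.
  rewrite le_max; apply/orP; right.
  have delta0 : 0 <= delta.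
    by apply: le_trans (mle 0%N); rewrite mulr_ge0 // ltW // ?up_weight_gt0 ?down_weight_gt0.
  have block l n : mass (up_weight x) (down_weight y) l (l + n) <= n%:R * delta.
    rewrite /mass mulrC mulr_natr -[X in _ *+ X](addKn l) -sumr_const_nat.
    by apply: ler_sum_nat => i _.
  have b1 := block 0%N Q; have b2 := block (M - Q - Q)%N (2 * Q)%N.
  rewrite add0n in b1; rewrite eM in b2.
  have TE : total_mass s = mass (up_weight x) (down_weight y) 0 Q +
     mass (up_weight x) (down_weight y) Q (M - Q - Q) +
     mass (up_weight x) (down_weight y) (M - Q - Q) M.
    by rewrite -total_massE (mass_cat _ _ (leq0n _) eQM) (mass_cat _ _ (leq0n _) eQ).
  have kd : (k * d)%:R * delta <= Q%:R * delta by rewrite ler_wpM2r // ler_nat.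
  have dE : 4 * (Q%:R * delta) = total_mass s * (4 * 3 ^+ s / L%:R).
    have QR0 : Q%:R != 0 :> rat by rewrite pnatr_eq0 -lt0n.
    by rewrite /delta natrM; field; rewrite QR0 lt0r_neq0.
  rewrite mulrBr mulr1 -dE TE; rewrite natrM in b2; lra.
have P0 : 0 <= (w ^+ s * (root_defect d x Q * root_defect d y Q / d%:R ^+ s)) ^+ k.
  by rewrite exprn_ge0.
apply: ler_pM mid.
- by rewrite mulr_ge0 // invr_ge0 exprn_ge0.
- by rewrite divr_ge0 ?exprn_ge0.
by apply: ler_pM; rewrite // invr_ge0 exprn_ge0.
Qed.

End Comparison.

(** * Balanced patterns dominate *)

Section Choice.

Variable R : archiRealFieldType.

Lemma bernoulli (z : R) n : -1 <= z -> 1 + n%:R * z <= (1 + z) ^+ n.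
Proof.
move=> z1; elim: n => [|n IHn]; first by rewrite mul0r addr0.
have z0 : 0 <= 1 + z by lra.
rewrite exprSr; apply: le_trans (ler_wpM2r z0 IHn).
have h : 0 <= n%:R * (z * z) by rewrite mulr_ge0 // -expr2 sqr_ge0.
by rewrite -natr1; move: h; move: (n%:R : R) => N; nra.
Qed.

(** The exponential gain g survives a loss of mass A / L if L is large, and then
    beats any constant depending on L if k is large. *)
Lemma choose_scale (g A : R) (d n : nat) : 1 < g -> 0 <= A ->
  exists L k : nat, [/\ (1 < L)%N, A <= L%:R &
    4 * (3 * L)%:R ^+ n <= (g * (1 - A / L%:R) ^+ d) ^+ k].
Proof.
move=> g1 A0; have g0 : 0 < g - 1 by rewrite subr_gt0.
have gg : 0 <= g by apply: ltW (lt_trans ltr01 g1).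
have D0 : 0 <= d%:R :> R by [].
have z1 : 0 <= 2 * d%:R * A * g / (g - 1).
  by rewrite divr_ge0 ?(ltW g0) // !mulr_ge0.
have z0 : 0 <= 2 * d%:R * A * g / (g - 1) + A by rewrite addr_ge0.
have [L L1 zL] : exists2 L, (1 < L)%N & 2 * d%:R * A * g / (g - 1) + A <= L%:R.
  exists (Num.bound (2 * d%:R * A * g / (g - 1) + A)).+2 => //.
  by apply/ltW/(lt_le_trans (archi_boundP z0)); rewrite ler_nat; lia.
have L0 : 0 < L%:R :> R by rewrite ltr0n; lia.
have AL : A <= L%:R by apply: le_trans zL; rewrite lerDr.
have eta1 : A / L%:R <= 1 by rewrite ler_pdivrMr // mul1r.
have etag : g * (d%:R * (A / L%:R)) <= (g - 1) / 2.
  have h : 2 * d%:R * A * g <= L%:R * (g - 1).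
    by rewrite -ler_pdivrMr //; apply: le_trans zL; rewrite lerDl.
  have -> : g * (d%:R * (A / L%:R)) = 2 * d%:R * A * g / L%:R / 2.
    by field; rewrite lt0r_neq0.
  by rewrite ler_wpM2r ?invr_ge0 ?ler0n // ler_pdivrMr // [X in _ <= X]mulrC.
have h1 : 1 + (g - 1) / 2 <= g * (1 - A / L%:R) ^+ d.
  have m1 : -1 <= - (A / L%:R) by rewrite lerN2.
  apply: le_trans (ler_wpM2l gg (bernoulli d m1)).
  by rewrite mulrN mulrBr mulr1; lra.
have g20 : 0 < (g - 1) / 2 by rewrite divr_gt0.
have C0 : 0 <= 4 * (3 * L)%:R ^+ n / ((g - 1) / 2).
  by apply: divr_ge0 (ltW g20); rewrite mulr_ge0 ?exprn_ge0 ?ler0n.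
exists L, (Num.bound (4 * (3 * L)%:R ^+ n / ((g - 1) / 2))); split=> //.
have := archi_boundP C0; set k := Num.bound _; rewrite ltr_pdivrMr // => hk.
apply: le_trans (ltW hk) _; apply: le_trans (_ : (1 + (g - 1) / 2) ^+ k <= _).
  have m1 : -1 <= (g - 1) / 2 by lra.
  by apply: le_trans (bernoulli k m1); rewrite lerDr.
have p : 0 <= 1 + (g - 1) / 2 by lra.
by rewrite lerXn2r ?nnegrE // (le_trans p).
Qed.

End Choice.

(** The tail bound in the form in which it is used: all errors that vanish as Q
    grows are powers of (Q - s) / (Q + s). *)
Lemma root_defect_near (d x s Q M : nat) : (0 < d)%N -> (x <= s)%N -> (s < Q <= M)%N ->
  ((Q - s)%:R / (Q + s)%:R) ^+ d * root_defect d x M <= root_defect d x Q.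
Proof.
move=> d0 xs /andP[sQ QM].
have Q0 : (0 < Q)%N by lia.
have := root_defect_tail d0 x (_ : 0 < Q <= M)%N; rewrite Q0 QM => /(_ isT) h.
set w := _ / _; have w0 : 0 <= w by rewrite divr_ge0.
have c0 : 0 <= root_defect d x Q by rewrite ltW // root_defect_gt0.
apply: le_trans (ler_wpM2l (exprn_ge0 d w0) h) _.
rewrite mulrCA -exprMn -[X in _ <= X]mulr1 ler_wpM2l // exprn_ile1 //.
  by rewrite mulr_ge0 // addr_ge0 // divr_ge0.
have wE : w * (Q + s)%:R = (Q - s)%:R by rewrite /w divfK // pnatr_eq0; lia.
have QR : 0 < Q%:R :> rat by rewrite ltr0n.
have h1 : x%:R / (d * Q)%:R <= s%:R / Q%:R :> rat.
  apply: le_trans (natdiv_le x Q0 (leq_pmull Q d0)) _.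
  by rewrite ler_wpM2r ?invr_ge0 // ler_nat.
apply: le_trans (_ : w * (1 + s%:R / Q%:R) <= _).
  by rewrite ler_wpM2l // lerD2l.
rewrite (_ : 1 + s%:R / Q%:R = (Q + s)%:R / Q%:R); last first.
  by rewrite natrD mulrDl divff // lt0r_neq0.
by rewrite mulrA wE ler_pdivrMr // mul1r ler_nat leq_subr.
Qed.

Lemma ratio_exp_ge_half (e s Q : nat) : (s < Q)%N -> (4 * e * s <= Q)%N ->
  1 / 2 <= ((Q - s)%:R / (Q + s)%:R) ^+ e :> rat.
Proof.
move=> sQ eQ; have p0 : 0 < (Q + s)%:R :> rat by rewrite ltr0n; lia.
have E : (Q - s)%:R / (Q + s)%:R = 1 + (- (2 * s%:R / (Q + s)%:R)) :> rat.
  rewrite natrB 1?ltnW //; move: p0; rewrite natrD => p0.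
  by field; rewrite lt0r_neq0.
have small : 2 * s%:R / (Q + s)%:R <= 1 :> rat.
  by rewrite ler_pdivrMr // mul1r -natrM ler_nat; lia.
rewrite E; apply: le_trans (bernoulli _ _); last by rewrite lerN2.
have h : e%:R * (2 * s%:R / (Q + s)%:R) <= 1 / 2 :> rat.
  rewrite mulrA ler_pdivrMr // -natrM -natrM mulrAC ler_pdivlMr // -natrM mul1r ler_nat.
  lia.
lra.
Qed.

(** The order of the choices matters: L depends on the gain g, then k on L, and
    finally Q on k, which makes the errors in Q at most a factor 2. *)
Lemma spread_dominates d x y x' y' : (1 < d)%N -> (x + y = x' + y')%N ->
  (x * y < x' * y')%N -> exists k, forall B, exists2 M, (B <= M)%N &
  (2 * chain_sum M x d y k <= chain_sum M x' d y' k)%N.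
Proof.
move=> d1 sumE prodE; have d0 : (0 < d)%N by apply: ltnW.
have [g g1 hg] := root_defect_spread d0 sumE prodE d1.
set s := (x + y)%N in sumE *.
have A0 : 0 <= 4 * 3 ^+ s :> rat by exact: mulr_ge0 (ler0n _ 4) (exprn_ge0 s (ler0n _ 3)).
have [L [k [L1 L4 kC]]] := choose_scale d (s * d).+1 g1 A0.
set eta : rat := 4 * 3 ^+ s / L%:R in kC.
exists k => B; pose e := ((s + d + d) * k)%N.
pose Q := (B + s + 1 + k * d + 4 * e * s)%N.
have sQ : (s < Q)%N by rewrite /Q; lia.
have kQ : (k * d <= Q)%N by rewrite /Q; lia.
have eQ : (4 * e * s <= Q)%N by rewrite /Q; lia.
have BQ : (B <= Q)%N by rewrite /Q; lia.
pose M := (3 * L * Q)%N.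
have QM : (Q <= M)%N by rewrite /M leq_pmull //; lia.
have M0 : (0 < M)%N by lia.
exists M; first exact: leq_trans QM.
have up := chain_sum_sharp_upper d0 M0 x y k.
have := @chain_sum_sharp_lower d M d0 M0 x' y' k L Q erefl L1.
rewrite -sumE => /(_ sQ kQ L4).
set w : rat := (Q - s)%:R / (Q + s)%:R; set T := total_mass d M s; set F := (k * d)`!%:R.
set K' := w ^+ s * _; rewrite -/eta => low.
set h := g * _ in kC; set C := 4 * _ in kC.
rewrite -/s -/T -/F in up; pose K : rat := root_defect d x M * root_defect d y M / d%:R ^+ s.
rewrite -/K in up.
have w0 : 0 <= w by rewrite divr_ge0.
have dxs : 0 < d%:R ^+ s :> rat by rewrite exprn_gt0 // ltr0n.
have cp u n : 0 <= root_defect d u n by rewrite ltW // root_defect_gt0.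
have K0 : 0 <= K by rewrite divr_ge0 ?mulr_ge0 ?(ltW dxs).
have KK' : w ^+ (s + d + d) * (g * K) <= K'.
  have sQM : (s < Q <= M)%N by rewrite sQ.
  have c1 := root_defect_near d0 (_ : x' <= s)%N sQM.
  have c2 := root_defect_near d0 (_ : y' <= s)%N sQM.
  have wd : 0 <= w ^+ d by rewrite exprn_ge0.
  rewrite [X in X <= _](_ : _ = w ^+ s * ((w ^+ d * w ^+ d) *
    (g * (root_defect d x M * root_defect d y M)) / d%:R ^+ s)); last first.
    by rewrite (exprD w (s + d)) (exprD w s) /K; ring.
  rewrite /K' ler_wpM2l ?exprn_ge0 // ler_wpM2r ?invr_ge0 ?(ltW dxs) //.
  apply: le_trans (ler_wpM2l (mulr_ge0 wd wd) (hg M M0)) _; rewrite mulrACA.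
  apply: ler_pM (c1 _) (c2 _); rewrite ?mulr_ge0 // sumE; first exact: leq_addr.
  exact: leq_addl.
have half : 1 / 2 <= w ^+ e by apply: ratio_exp_ge_half.
have F0 : 0 < F by rewrite ltr0n fact_gt0.
have T0 : 0 < T by rewrite total_mass_gt0.
have gK0 : 0 <= g * K by rewrite mulr_ge0 //; lra.
have KKk : 1 / 2 * (g ^+ k * K ^+ k) <= K' ^+ k.
  apply: le_trans (_ : (w ^+ (s + d + d) * (g * K)) ^+ k <= _); last first.
    have l0 : 0 <= w ^+ (s + d + d) * (g * K) by rewrite mulr_ge0 ?exprn_ge0.
    by rewrite lerXn2r ?nnegrE ?l0 ?(le_trans l0 KK').
  rewrite (exprMn k (w ^+ _)) -(exprM w) (exprMn k g) -/e ler_wpM2r //.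
  by rewrite -exprMn exprn_ge0.
pose Z := K ^+ k * (T ^+ (k * d) / F).
have TF0 : 0 <= T ^+ (k * d) / F by exact: divr_ge0 (exprn_ge0 _ (ltW T0)) (ltW F0).
have Z0 : 0 <= Z by exact: mulr_ge0 (exprn_ge0 _ K0) TF0.
have eta1 : 0 <= 1 - eta by rewrite subr_ge0 ler_pdivrMr ?mul1r // ltr0n ltnW.
have big : 2 * (M%:R * Z) <= (chain_sum M x' d y' k)%:R.
  apply: le_trans low.
  have L30 : 0 < (3 * L)%:R :> rat by rewrite ltr0n muln_gt0 (ltnW L1).
  have L3V0 : 0 <= (3 * L)%:R ^- (s * d) :> rat.
    by rewrite invr_ge0; apply: exprn_ge0 (ltW L30).
  have tE : (T * (1 - eta)) ^+ (k * d) / F =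
            T ^+ (k * d) / F * ((1 - eta) ^+ d) ^+ k.
    by rewrite exprMn -exprM [(d * k)%N]mulnC mulrAC.
  rewrite tE.
  apply: le_trans (_ : Q%:R * ((3 * L)%:R ^- (s * d) * (1 / 2 * (g ^+ k * K ^+ k)) *
     (T ^+ (k * d) / F * ((1 - eta) ^+ d) ^+ k)) <= _); last first.
    apply: ler_wpM2l (ler0n _ _) _ _ _; apply: ler_wpM2r.
      exact: mulr_ge0 TF0 (exprn_ge0 _ (exprn_ge0 _ eta1)).
    exact: ler_wpM2l L3V0 _ _ KKk.
  rewrite [X in _ <= X](_ : _ = Q%:R * ((3 * L)%:R ^- (s * d) * (1 / 2 * h ^+ k) * Z)); last first.
    by rewrite /h /Z (exprMn k g); ring.
  apply: le_trans (_ : Q%:R * ((3 * L)%:R ^- (s * d) * (1 / 2 * C) * Z) <= _); last first.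
    apply: ler_wpM2l (ler0n _ _) _ _ _; apply: ler_wpM2r Z0 _ _ _.
    apply: ler_wpM2l L3V0 _ _ _; apply: ler_wpM2l kC.
    exact: divr_ge0 ler01 (ler0n _ 2).
  rewrite /M natrM /C exprS le_eqVlt; apply/orP; left; apply/eqP; field.
  by rewrite expf_neq0 // lt0r_neq0.
rewrite -(ler_nat rat) natrM; apply: le_trans big; rewrite ler_wpM2l //.
by apply: (le_trans up); rewrite /Z mulrCA.
Qed.

(** * The end values are determined *)

Local Close Scope ring_scope.

Lemma chain_sum_close N (p t : 'S_N.+1) x d y x' d' y' k :
  strongly_c_wilf_equivalent p t ->
  p ord0 = x :> nat -> p ord_max = x + d.+1 :> nat -> N = x + d.+1 + y ->
  t ord0 = x' :> nat -> t ord_max = x' + d'.+1 :> nat -> N = x' + d'.+1 + y' ->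
  close (k * N).+1 (fun M => chain_sum M x d.+1 y k)
                   (fun M => chain_sum M x' d'.+1 y' k).
Proof.
move=> eqv p0 pm Np t0 tm Nt; have N0 : 0 < N by lia.
apply: close_ext (cluster_count_close eqv (n := (k * N).+1) k isT) => M.
  by rewrite cluster_count_chain // (marked_count_chain p0 pm Np).
by rewrite cluster_count_chain // (marked_count_chain t0 tm Nt).
Qed.

Lemma close_wide_gap d x y x' y' : 1 < d -> x + y = x' + y' -> x <= y -> x' <= y' ->
  (forall k, close (k * (x' + d + y')).+1
     (fun M => chain_sum M x d y k) (fun M => chain_sum M x' d y' k)) ->
  x' <= x.
Proof.
move=> d1 sumE xy xy' Hc; rewrite leqNgt; apply/negP => xx'.
have prodE : x * y < x' * y' by nia.
have [k dom] := spread_dominates d1 sumE prodE.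
exact: close_contradiction (Hc k) (@chain_sum_crude_lower x' d y' k) dom.
Qed.

(** The condition p_1 + p_m <= m + 1 says that at least as many values lie above
    the last entry as below the first one. *)
Lemma standard_shape N (p : 'S_N.+1) : standard p ->
  exists x d y, [/\ p ord0 = x :> nat, p ord_max = x + d.+1 :> nat,
    N = x + d.+1 + y & x <= y].
Proof.
rewrite /standard /entry /= (nth_one_line p ord0) (nth_one_line p ord_max).
move=> /andP[lt_p le_p]; have := ltn_ord (p ord_max).
exists (p ord0), (p ord_max - p ord0).-1, (N - p ord_max); split; lia.
Qed.

Theorem corollary1p2 (m : nat) (p t : 'S_m)
    (p_standard : standard p) (t_standard : standard t)
    (p_t_equiv : strongly_c_wilf_equivalent p t) :
  (entry p 1, entry p m) = (entry t 1, entry t m).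
Proof.
case: m p t p_standard t_standard p_t_equiv => [|N] p t sp st eqv.
  by move: sp; rewrite /standard /entry /one_line !nth_default ?size_image ?card_ord.
have [x [d [y [p0 pm Np xy]]]] := standard_shape sp.
have [x' [d' [y' [t0 tm Nt xy']]]] := standard_shape st.
have Hc k := chain_sum_close k eqv p0 pm Np t0 tm Nt.
have sumE : x + d.+1 + y = x' + d'.+1 + y' by rewrite -Np -Nt.
have le_d : d <= d'.
  by rewrite -ltnS; apply: (close_same_gap (esym sumE)) => k; rewrite -Nt; apply/close_sym/Hc.
have ge_d : d' <= d.
  by rewrite -ltnS; apply: (close_same_gap sumE) => k; rewrite -Np; apply: Hc.
have dd' : d = d' by apply/eqP; rewrite eqn_leq le_d.
have xx' : x = x'.
  subst d'; have {}sumE : x + y = x' + y' by lia.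
  have Hc' k := close_sym (Hc k).
  apply/eqP; rewrite eqn_leq; case: (posnP d) => [d0|d0]; apply/andP; split.
  - apply: (@close_unit_gap x' y' x y) => //; move: (Hc' 2); rewrite d0.
    by rewrite (_ : (_ + _).*2 + 3 = (2 * N).+1) //; lia.
  - apply: (@close_unit_gap x y x' y') => //; move: (Hc 2); rewrite d0.
    by rewrite (_ : (_ + _).*2 + 3 = (2 * N).+1) //; lia.
  - by apply: (@close_wide_gap d.+1 x' y' x y) => // k; rewrite -Np.
  by apply: (@close_wide_gap d.+1 x y x' y') => // k; rewrite -Nt.
rewrite /entry /= (nth_one_line p ord0) (nth_one_line t ord0).
by rewrite (nth_one_line p ord_max) (nth_one_line t ord_max) p0 pm t0 tm xx' dd'.
Qed.
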